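(* Let $n \ge 2$ and let $\Diamond^n \subset \mathbb{R}^n$ be the standard cross-polytope. Let $K \subset \mathbb{R}^n$ be a convex body such that $gK = K$ for every $g \in SO(\Diamond^n)$. Then $$|K|\,|K^\circ| \;\ge\; |\Diamond^n|\,|(\Diamond^n)^\circ| \;=\; \frac{4^n}{n!}.$$
   Context: A convex body in $\mathbb{R}^n$ is a compact convex set with nonempty interior. $|\cdot|$ denotes $n$-dimensional Lebesgue measure. The cross-polytope is $\Diamond^n = \operatorname{conv}\{\pm e_1,\dots,\pm e_n\}$ ($e_i$ the standard basis vectors), which is the polar of the $n$-cube $[-1,1]^n$. $SO(\Diamond^n) := \{g \in SO(n) : g\Diamond^n = \Diamond^n\}$. For a convex body $K$ with the origin in its interior, $K^\circ := \{y \in \mathbb{R}^n : y\cdot x \le 1 \text{ for all } x \in K\}$ with the standard inner product. A convex body invariant under $SO(\Diamond^n)$ has its centroid at the origin, so the origin lies in its interior. *)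

(* Defs.v *)
From HB Require Import structures.
From mathcomp Require Import all_boot all_order all_algebra.
From mathcomp Require Import all_classical all_reals all_analysis.

Set Implicit Arguments.
Unset Strict Implicit.
Unset Printing Implicit Defensive.

Import Order.TTheory GRing.Theory Num.Theory.
Import numFieldNormedType.Exports.

Local Open Scope classical_set_scope.
Local Open Scope ring_scope.

Section lebesgue_tuple_step.
Context (R : realType) (n : nat).
Variable mu : {sigma_finite_measure set (n.-tuple (measurableTypeR R)) -> \bar R}.

Definition tuple_cons (p : measurableTypeR R * n.-tuple (measurableTypeR R)) :
  n.+1.-tuple (measurableTypeR R) := [tuple of p.1 :: p.2].

Lemma measurable_tuple_cons : measurable_fun setT tuple_cons.
Proof. exact: measurable_cons. Qed.

Definition lebesgue_tupleS : set (n.+1.-tuple (measurableTypeR R)) -> \bar R :=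
  pushforward (lebesgue_measure \x mu)%E tuple_cons.

Let lebesgue_tupleS0 : lebesgue_tupleS set0 = 0%E.
Proof. by rewrite /lebesgue_tupleS /pushforward preimage_set0 measure0. Qed.

Let lebesgue_tupleS_ge0 A : (0 <= lebesgue_tupleS A)%E.
Proof. exact: (measure_ge0 (lebesgue_measure \x mu)%E). Qed.

Let lebesgue_tupleS_sigma_additive : semi_sigma_additive lebesgue_tupleS.
Proof.
move=> F mF tF mUF; rewrite /lebesgue_tupleS /pushforward preimage_bigcup.
apply: measure_semi_sigma_additive.
- by move=> k; rewrite -[X in measurable X]setTI; exact: measurable_tuple_cons.
- apply/trivIsetP => /= i j _ _ ij; rewrite -preimage_setI.
  by move/trivIsetP : tF => /(_ _ _ _ _ ij) ->//; rewrite preimage_set0.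
- rewrite -preimage_bigcup -[X in measurable X]setTI.
  exact: measurable_tuple_cons.
Qed.

HB.instance Definition _ := isMeasure.Build _ _ _ lebesgue_tupleS
  lebesgue_tupleS0 lebesgue_tupleS_ge0 lebesgue_tupleS_sigma_additive.

Definition tuple_setX (A : set (measurableTypeR R))
    (B : set (n.-tuple (measurableTypeR R))) :
  set (n.+1.-tuple (measurableTypeR R)) :=
  [set t | A (thead t) /\ B [tuple of behead t]].

Lemma measurable_tuple_setX A B :
  measurable A -> measurable B -> measurable (tuple_setX A B).
Proof.
move=> mA mB; apply: measurableI.
- by rewrite -[X in measurable X]setTI; exact: measurable_tnth.
- by rewrite -[X in measurable X]setTI; exact: measurable_behead.
Qed.

Lemma lebesgue_tupleSE A B : measurable A -> measurable B ->
  lebesgue_tupleS (tuple_setX A B) = (lebesgue_measure A * mu B)%E.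
Proof.
move=> mA mB; rewrite -product_measure1E//; congr product_measure1.
apply/seteqP; split=> -[x t] /=; rewrite /tuple_setX/= theadE.
- by move=> [Ax]; rewrite (_ : [tuple of _] = t)//; exact/val_inj.
- by move=> [Ax Bt]; split=> //; rewrite (_ : [tuple of _] = t)//; exact/val_inj.
Qed.

Let lebesgue_tupleS_sigma_finite : sigma_finite setT lebesgue_tupleS.
Proof.
have /sigma_finiteP[F [TF ndF Foo]] := sigma_finiteT (@lebesgue_measure R).
have /sigma_finiteP[G [TG ndG Goo]] := sigma_finiteT mu.
exists (fun k => tuple_setX (F k) (G k)).
  apply/seteqP; split=> // t _.
  have [i _ Fi] : (\bigcup_k F k) (thead t) by rewrite -TF.
  have [j _ Gj] : (\bigcup_k G k) [tuple of behead t] by rewrite -TG.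
  exists (maxn i j) => //; split.
  - by move: Fi; exact/subsetPset/ndF/leq_maxl.
  - by move: Gj; exact/subsetPset/ndG/leq_maxr.
move=> k; have [mF Fk] := Foo k; have [mG Gk] := Goo k; split.
  exact: measurable_tuple_setX.
by rewrite lebesgue_tupleSE// lte_mul_pinfty// ge0_fin_numE.
Qed.

HB.instance Definition _ := Measure_isSigmaFinite.Build _ _ _ lebesgue_tupleS
  lebesgue_tupleS_sigma_finite.

End lebesgue_tuple_step.

Fixpoint lebesgue_tuple (R : realType) (n : nat) :
    {sigma_finite_measure set (n.-tuple (measurableTypeR R)) -> \bar R} :=
  if n is m.+1 then lebesgue_tupleS (lebesgue_tuple R m)
  else dirac ([tuple] : 0.-tuple (measurableTypeR R)).

Lemma lebesgue_tuple_box (R : realType) (n : nat)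
    (A : 'I_n -> set (measurableTypeR R)) : (forall i, measurable (A i)) ->
  lebesgue_tuple R n [set t | forall i, A i (tnth t i)] =
  (\prod_(i < n) lebesgue_measure (A i))%E.
Proof.
elim: n A => [|n IHn] A mA.
  rewrite big_ord0 /= diracE mem_set//; by case.
have mB : measurable [set t : n.-tuple (measurableTypeR R) |
    forall i, A (lift ord0 i) (tnth t i)].
  rewrite [X in measurable X](_ : _ =
    \bigcap_(i in [set: 'I_n]) ((fun t => tnth t i) @^-1` A (lift ord0 i))).
    apply: fin_bigcap_measurable => // i _.
    by rewrite -[X in measurable X]setTI; exact: measurable_tnth.
  by apply/seteqP; split=> t /= tA i; [move=> _; exact: tA|exact: (tA i I)].
rewrite big_ord_recl -IHn// -lebesgue_tupleSE//.
have beheadE (t : n.+1.-tuple (measurableTypeR R)) i :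
    tnth [tuple of behead t] i = tnth t (lift ord0 i).
  by rewrite tnth_behead; congr tnth; apply/val_inj; rewrite /= inordK ?ltnS.
congr lebesgue_tupleS; apply/seteqP; split=> t /=.
- by move=> tA; split=> [|i /=]; rewrite ?beheadE; exact: tA.
- move=> [tA0 tA] i; case: (unliftP ord0 i) => [j ->|->//].
  by rewrite -beheadE; exact: tA.
Qed.

(* A row vector is sent to the tuple of its coordinates, so that [volume] is
   the product Lebesgue measure characterized by [lebesgue_tuple_box]; it is
   meaningful on Borel sets, in particular on compact sets. *)
Definition volume (R : realType) (n : nat) (A : set 'rV[R]_n) : \bar R :=
  lebesgue_tuple R n [set t | A (\row_i tnth t i)].

Definition dotv (R : realType) (n : nat) (x y : 'rV[R]_n) : R :=
  \sum_i x 0 i * y 0 i.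

Definition convex_body (R : realType) (n : nat) (K : set 'rV[R]_n) : Prop :=
  [/\ compact K, convex_set (K : set (convex_lmodType 'rV[R]_n))
    & K° !=set0].

Definition polar (R : realType) (n : nat) (K : set 'rV[R]_n) : set 'rV[R]_n :=
  [set y | forall x, K x -> dotv y x <= 1].

Definition conv_hull (R : realType) (n : nat) (A : set 'rV[R]_n) :
    set 'rV[R]_n :=
  smallest (@convex_set R 'rV[R]_n) A.

Definition cross_polytope (R : realType) (n : nat) : set 'rV[R]_n :=
  conv_hull [set v | exists i : 'I_n, v = delta_mx 0 i \/ v = - delta_mx 0 i].
Arguments cross_polytope : clear implicits.

Definition special_orthogonal (R : realType) (n : nat) : set 'M[R]_n :=
  [set g | g *m g^T = 1%:M /\ \det g = 1].

(* Points are row vectors; the column vector g *m x^T is, as a row, x *m g^T. *)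
Definition mx_act (R : realType) (n : nat) (g : 'M[R]_n) (x : 'rV[R]_n) :
    'rV[R]_n :=
  x *m g^T.

Definition SO_stab (R : realType) (n : nat) (A : set 'rV[R]_n) : set 'M[R]_n :=
  [set g | special_orthogonal g /\ mx_act g @` A = A].

(* Main.v *)
Require Import Defs.
From mathcomp Require Import all_boot all_order all_algebra all_fingroup.
From mathcomp Require Import finmap all_classical all_reals all_analysis.
From mathcomp Require Import unstable measurable_realfun.
From mathcomp Require Import ring lra zify.

(** The inequality rests on one fact about mixed volumes ([zonotope_volume]):
    if a convex body L in dimension n contains the zonotope Z that is the sum of
    the segments [-w, w], then the sum over w of 2 |w| times the volume of the
    projection of L along w is at most n vol L; with the projection taken onto a
    coordinate hyperplane x_i = 0, the factor |w| becomes |w_i|.  Indeed, L + tZ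
    lies in (1 + t) L, whose volume is (1 + t)^n vol L, whereas adding the segments
    [-tw, tw] one after the other increases the volume by at least
    2t |w| vol (proj_w L) each time, by Fubini in the direction w ([vol_sweep]);
    now let t tend to 0.

    Suppose n >= 3, and let x in K maximize the sum of the |x_i|, with a its
    maximal mean.  Averaging the images of x under the group shows that K contains
    the cube [-a, a]^n ([mean_cube]): the signed permutations of determinant 1
    still act transitively on the coordinates once the signs are prescribed.  By
    maximality the polar of K contains the cube with half-side b = 1/(na).  With the
    coordinate segments as w, the fact above gives vol K >= 2a vol (P K) and
    vol (polar K) >= 2b vol (P (polar K)), where P forgets one coordinate (any
    one, by symmetry).  Since P (polar K) contains polar (P K),
    vol K vol (polar K) >= (4/n) vol (P K) vol (polar (P K))
    ([volume_product_step]).  A signed permutation of n - 1 coordinates extends to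
    one of determinant 1 by a choice of sign for the last, so P K is invariant
    under all signed permutations.  The same averaging then works in every
    dimension, and induction down to dimension 0 gives 4^n / n!.

    For n = 2 the group consists of the quarter turns only, which single out no
    axes.  The same fact is then applied to two squares, one in K with sides along
    u and Ju, and one in the polar of K with sides along v and Jv, where J is the
    quarter turn and u.v = 1/2.  It gives vol K >= 4 u.q for every q in K, and
    likewise vol (polar K) >= 4 v.q' for every q' in the polar
    ([quarter_turn_volume]).  If q maximizes u.q, then q' = u/(u.q) is in the polar,
    and the product of the two bounds is 16 u.v = 8
    ([quarter_turn_volume_product]).

    On the other side, the cross-polytope is the unit ball of the l^1 norm, its
    polar is the cube [-1, 1]^n, and slicing gives its volume 2^n / n!
    ([vol_l1_ball]). *)

Set Implicit Arguments.
Unset Strict Implicit.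
Unset Printing Implicit Defensive.

Import Order.TTheory GRing.Theory Num.Theory.
Import numFieldNormedType.Exports.

Local Open Scope classical_set_scope.
Local Open Scope ring_scope.

(** * Lebesgue measure on the line under translation and dilation *)

Section lebesgue_line.
Context (R : realType).
Notation lambda := (@lebesgue_measure R).
Notation mR := (measurableTypeR R).

Lemma measurable_shift (c : R) : measurable_fun setT ((fun x => x + c) : mR -> mR).
Proof. by apply: measurable_funD => //; exact: measurable_id. Qed.

Lemma measurable_scale (c : R) : measurable_fun setT ((fun x => c * x) : mR -> mR).
Proof. by apply: measurable_funM => //; exact: measurable_id. Qed.

Lemma lebesgue_measure_shift (c : R) (A : set mR) : measurable A ->
  lambda [set x | A (x + c)] = lambda A.
Proof.
move=> mA.
pose f : mR -> mR := fun x => x + c.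
have mf : measurable_fun setT f := measurable_shift c.
pose m : {measure set mR -> \bar R} :=
  measure_function_pushforward__canonical__measure_function_Measure lambda mf.
suff /= -> : lambda A = m A by [].
apply: lebesgue_measure_unique => // _ [[a b] _ <-] /=.
rewrite /pushforward (_ : f @^-1` _ = [set` `]a - c, b - c]%R]).
  rewrite !lebesgue_measure_itv /= !lte_fin ltrD2r.
  by case: ifP => // _; rewrite -!EFinD; congr EFin; ring.
by apply/seteqP; split => x /=; rewrite /f !in_itv /= ltrBlDr lerBrDr.
Qed.

Lemma lebesgue_measure_scale (c : R) (A : set mR) : 0 < c -> measurable A ->
  lambda [set x | A (c * x)] = (c^-1%:E * lambda A)%E.
Proof.
move=> c0 mA.
pose f : mR -> mR := fun x => c * x.
have mf : measurable_fun setT f := measurable_scale c.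
pose m : {measure set mR -> \bar R} :=
  measure_function_pushforward__canonical__measure_function_Measure lambda mf.
have c0' : (0 <= c)%R by exact: ltW.
pose m' : {measure set mR -> \bar R} := mscale (NngNum c0') m.
have -> : lambda A = m' A.
  apply: lebesgue_measure_unique => // _ [[a b] _ <-] /=.
  rewrite /mscale/= /pushforward (_ : f @^-1` _ = [set` `]a / c, b / c]%R]).
    rewrite !lebesgue_measure_itv /= !lte_fin ltr_pM2r ?invr_gt0//.
    case: ifP => _; last by rewrite mule0.
    by rewrite -!EFinD -EFinM; congr EFin; field; exact: lt0r_neq0.
  apply/seteqP; split => x /=; rewrite /f !in_itv /= ltr_pdivrMr//.
  - by rewrite ler_pdivlMr// mulrC.
  - by rewrite ler_pdivlMr// mulrC.
by rewrite /m' /= /mscale /= muleA -EFinM mulVf ?mul1e//; exact: lt0r_neq0.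
Qed.
End lebesgue_line.

(** * Product Lebesgue measure under affine changes of coordinates *)

Section lebesgue_tuple_maps.
Context (R : realType) (n : nat).
Notation lambda := (@lebesgue_measure R).
Notation mR := (measurableTypeR R).
Notation mu := (lebesgue_tuple R n).

Definition box (A : 'I_n -> set mR) : set (n.-tuple mR) :=
  [set t | forall i, A i (tnth t i)].

Lemma measurable_box A : (forall i, measurable (A i)) -> measurable (box A).
Proof.
move=> mA; rewrite [X in measurable X](_ : _ =
    \bigcap_(i in [set: 'I_n]) ((fun t => tnth t i) @^-1` A i)).
  apply: fin_bigcap_measurable => // i _.
  by rewrite -[X in measurable X]setTI; exact: measurable_tnth.
by apply/seteqP; split=> t /= tA i; [move=> _; exact: tA|exact: (tA i I)].
Qed.

Lemma measurable_tuple_boxes : measurable =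
  <<s [set B : set (n.-tuple mR) |
       exists2 A, (forall i, measurable (A i)) & B = box A] >>.
Proof.
apply/seteqP; split; last first.
  apply: smallest_sub; first exact: sigma_algebra_measurable.
  by move=> _ [A mA ->]; exact: measurable_box.
apply: smallest_sub; first exact: smallest_sigma_algebra.
move=> B /=; rewrite -bigcup_seq /= => -[i _ [A mA <-]].
apply: sub_sigma_algebra => /=.
exists (fun j => if j == i then A else setT) => [j|].
  by case: eqP => // _; exact: measurableT.
rewrite setTI; apply/seteqP; split => t /= tA.
- by move=> j; case: eqP => // ->.
- by have := tA i; rewrite eqxx.
Qed.

Lemma lebesgue_tuple_unique (m : {measure set (n.-tuple mR) -> \bar R}) :
  (forall A, (forall i, measurable (A i)) ->
     m (box A) = (\prod_(i < n) lambda (A i))%E) ->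
  forall X, measurable X -> mu X = m X.
Proof.
move=> mbox; pose cube k : set (n.-tuple mR) :=
  box (fun=> [set` `[- k%:R, k%:R : R]%R]).
have mitv k : measurable ([set` `[- k%:R, k%:R : R]%R] : set mR).
  exact: measurable_itv.
apply: (measure_unique _ cube); first exact: measurable_tuple_boxes.
- move=> _ _ [A mA ->] [B mB ->]; exists (fun i => A i `&` B i).
    by move=> i; exact: measurableI.
  apply/seteqP; split => t /=.
  - by move=> [tA tB] i; split; [exact: tA|exact: tB].
  - by move=> tAB; split=> i; case: (tAB i).
- by move=> k; exists (fun=> [set` `[- k%:R, k%:R : R]%R]).
- apply/seteqP; split => // t _.
  exists (\max_i Num.truncn `|tnth t i| + 1)%N => // i /=.
  rewrite in_itv /= -ler_norml (le_trans (ltW (truncnS_gt _)))// ler_nat.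
  by rewrite addn1 ltnS leq_bigmax.
- by move=> _ [A mA ->]; rewrite mbox//; exact: lebesgue_tuple_box.
- move=> k; rewrite [X in (X < _)%E](lebesgue_tuple_box (fun=> mitv k)).
  suff /andP[] :
      (0 <= \prod_(i < n) lambda [set` `[- k%:R, k%:R : R]%R] < +oo)%E by [].
  apply: (big_ind (fun x : \bar R => (0 <= x < +oo)%E)).
  - by rewrite ltry lee01.
  - move=> x y /andP[x0 xoo] /andP[y0 yoo]; rewrite mule_ge0//=.
    by rewrite lte_mul_pinfty// ge0_fin_numE.
  - by move=> i _; rewrite measure_ge0 /= lebesgue_measure_itv /=;
    case: ifP => _; rewrite ltry.
Qed.

Lemma lebesgue_tuple_preimage (f : n.-tuple mR -> n.-tuple mR) (c : R) :
  0 < c -> measurable_fun setT f ->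
  (forall A, (forall i, measurable (A i)) ->
     mu (f @^-1` box A) = (c%:E * \prod_(i < n) lambda (A i))%E) ->
  forall X, measurable X -> mu (f @^-1` X) = (c%:E * mu X)%E.
Proof.
move=> c0 mf fbox X mX.
pose m : {measure set (n.-tuple mR) -> \bar R} :=
  measure_function_pushforward__canonical__measure_function_Measure mu mf.
have c1 : (0 <= c^-1)%R by rewrite invr_ge0 ltW.
pose m' : {measure set (n.-tuple mR) -> \bar R} := mscale (NngNum c1) m.
have cK x : (c^-1%:E * (c%:E * x) = x)%E.
  by rewrite muleA -EFinM mulVf ?mul1e// lt0r_neq0.
have m'E Y : m' Y = (c^-1%:E * mu (f @^-1` Y))%E by [].
have -> : mu X = m' X.
  by apply: lebesgue_tuple_unique => // A mA; rewrite [LHS]m'E fbox.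
by rewrite [in RHS]m'E muleA -EFinM mulfV ?mul1e// lt0r_neq0.
Qed.

Lemma lebesgue_tuple_shift (v : 'I_n -> R) X : measurable X ->
  mu [set t | X [tuple tnth t i + v i | i < n]] = mu X.
Proof.
move=> mX; pose f (t : n.-tuple mR) : n.-tuple mR := [tuple tnth t i + v i | i < n].
rewrite -[RHS]mul1e -(@lebesgue_tuple_preimage f 1)//.
  apply/measurable_fun_tnthP => i.
  rewrite (_ : _ \o _ = (fun x => x + v i) \o (@tnth n mR ^~ i)).
    by apply: measurableT_comp; [exact: measurable_shift|exact: measurable_tnth].
  by apply/funext => t /=; rewrite tnth_mktuple.
move=> A mA; rewrite mul1e (_ : _ @^-1` _ = box (fun i => [set x | A i (x + v i)])).
  rewrite [LHS]lebesgue_tuple_box; last first.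
    move=> i; rewrite -[X in measurable X]setTI; exact: measurable_shift.
  by apply: eq_bigr => i _; exact: lebesgue_measure_shift.
by apply/seteqP; split => t /= tA i; have := tA i; rewrite tnth_mktuple.
Qed.

Lemma lebesgue_tuple_scale (c : R) X : 0 < c -> measurable X ->
  mu [set t | X [tuple c * tnth t i | i < n]] = ((c^-1 ^+ n)%:E * mu X)%E.
Proof.
move=> c0 mX.
pose f (t : n.-tuple mR) : n.-tuple mR := [tuple c * tnth t i | i < n].
rewrite -(@lebesgue_tuple_preimage f)//.
- by rewrite exprn_gt0// invr_gt0.
- apply/measurable_fun_tnthP => i.
  rewrite (_ : _ \o _ = (fun x => c * x) \o (@tnth n mR ^~ i)).
    by apply: measurableT_comp; [exact: measurable_scale|exact: measurable_tnth].
  by apply/funext => t /=; rewrite tnth_mktuple.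
move=> A mA; rewrite (_ : _ @^-1` _ = box (fun i => [set x | A i (c * x)])).
  rewrite [LHS]lebesgue_tuple_box; last first.
    move=> i; rewrite -[X in measurable X]setTI; exact: measurable_scale.
  rewrite -[n in (_ ^+ n)%R]card_ord -prodr_const -prodEFin -big_split /=.
  by apply: eq_bigr => i _; exact: lebesgue_measure_scale.
by apply/seteqP; split => t /= tA i; have := tA i; rewrite tnth_mktuple.
Qed.

Lemma lebesgue_tuple_perm (s : 'S_n) X : measurable X ->
  mu [set t | X [tuple tnth t (s i) | i < n]] = mu X.
Proof.
move=> mX; pose f (t : n.-tuple mR) : n.-tuple mR := [tuple tnth t (s i) | i < n].
rewrite -[RHS]mul1e -(@lebesgue_tuple_preimage f 1)//.
  apply/measurable_fun_tnthP => i.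
  rewrite (_ : _ \o _ = (@tnth n mR ^~ (s i))); first exact: measurable_tnth.
  by apply/funext => t /=; rewrite tnth_mktuple.
move=> A mA; rewrite mul1e (_ : _ @^-1` _ = box (fun i => A ((s^-1)%g i))).
  rewrite [LHS]lebesgue_tuple_box// (reindex_inj (@perm_inj _ s)) /=.
  by apply: eq_bigr => i _; rewrite permK.
apply/seteqP; split => t /= tA i.
  by have := tA ((s^-1)%g i); rewrite tnth_mktuple permKV.
by have := tA (s i); rewrite tnth_mktuple permK.
Qed.
End lebesgue_tuple_maps.

(** * Volume: Fubini and shears *)

Section volume_theory.
Context (R : realType).
Notation lambda := (@lebesgue_measure R).
Notation mR := (measurableTypeR R).

Definition tuples n (A : set 'rV[R]_n) : set (n.-tuple mR) :=
  [set t | A (\row_i tnth t i)].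

Lemma rowt_mktuple n (f : 'I_n -> R) :
  \row_i tnth (mktuple f) i = \row_i f i.
Proof. by apply/rowP => i; rewrite !mxE tnth_mktuple. Qed.

Lemma le_volume n (A B : set 'rV[R]_n) : measurable (tuples A) ->
  measurable (tuples B) -> A `<=` B -> (volume A <= volume B)%E.
Proof.
move=> mA mB AB; apply: le_measure; [exact: mem_set|exact: mem_set|].
by move=> t; exact: AB.
Qed.

Lemma volume_ge0 n (A : set 'rV[R]_n) : (0 <= volume A)%E.
Proof. exact: measure_ge0. Qed.

Lemma volume_shift n (v : 'rV[R]_n) (A : set 'rV[R]_n) :
  measurable (tuples A) -> volume [set x | A (x + v)] = volume A.
Proof.
move=> mA; rewrite /volume -[RHS](lebesgue_tuple_shift (v 0))//.
congr (lebesgue_tuple R n _); apply/seteqP; split => t /=;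
  rewrite /tuples /= (rowt_mktuple (fun i => tnth t i + v 0 i));
  by congr A; apply/rowP => i; rewrite !mxE.
Qed.

Lemma volume_scale n (c : R) (A : set 'rV[R]_n) : 0 < c ->
  measurable (tuples A) ->
  volume [set x | A (c *: x)] = ((c^-1 ^+ n)%:E * volume A)%E.
Proof.
move=> c0 mA; rewrite /volume -[RHS](lebesgue_tuple_scale c0)//.
congr (lebesgue_tuple R n _); apply/seteqP; split => t /=;
  rewrite /tuples /= (rowt_mktuple (fun i => c * tnth t i));
  by congr A; apply/rowP => i; rewrite !mxE.
Qed.

Lemma volume_perm n (s : 'S_n) (A : set 'rV[R]_n) :
  measurable (tuples A) ->
  volume [set x | A (col_perm s x)] = volume A.
Proof.
move=> mA; rewrite /volume -[RHS](lebesgue_tuple_perm s)//.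
congr (lebesgue_tuple R n _); apply/seteqP; split => t /=;
  rewrite /tuples /= (rowt_mktuple (fun i => tnth t (s i)));
  by congr A; apply/rowP => i; rewrite !mxE.
Qed.

Definition consv n (a : R) (z : 'rV[R]_n) : 'rV[R]_n.+1 :=
  \row_i oapp (z 0) a (unlift ord0 i).

Lemma consv0 n a (z : 'rV[R]_n) : consv a z 0 ord0 = a.
Proof. by rewrite mxE unlift_none. Qed.

Lemma consvS n a (z : 'rV[R]_n) i : consv a z 0 (lift ord0 i) = z 0 i.
Proof. by rewrite mxE liftK. Qed.

Lemma consv_tuple n (a : R) (t : n.-tuple mR) :
  \row_i tnth (tuple_cons (a, t)) i = consv a (\row_i tnth t i).
Proof.
apply/rowP => i; case: (unliftP ord0 i) => [j|] ->; rewrite ?consv0 ?consvS !mxE //.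
by rewrite tnthS.
Qed.

Lemma measurable_tuples_cons n (A : set 'rV[R]_n.+1) : measurable (tuples A) ->
  measurable (tuple_cons (R := R) (n := n) @^-1` tuples A).
Proof.
by move=> mA; rewrite -[X in measurable X]setTI; exact: measurable_tuple_cons.
Qed.

Lemma xsection_tuples n (A : set 'rV[R]_n.+1) (a : R) :
  xsection (tuple_cons (R := R) (n := n) @^-1` tuples A) a =
  tuples [set z | A (consv a z)].
Proof.
by apply/seteqP; split => t; rewrite /xsection /= inE /= /tuples /= consv_tuple.
Qed.

Lemma ysection_tuples n (A : set 'rV[R]_n.+1) (t : n.-tuple mR) :
  ysection (tuple_cons (R := R) (n := n) @^-1` tuples A) t =
  [set a | A (consv a (\row_i tnth t i))].
Proof.
by apply/seteqP; split => a; rewrite /ysection /= inE /= /tuples /= consv_tuple.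
Qed.

Lemma measurable_tuples_section n (A : set 'rV[R]_n.+1) a :
  measurable (tuples A) -> measurable (tuples [set z | A (consv a z)]).
Proof.
move=> mA; rewrite -xsection_tuples.
by apply: measurable_xsection; exact: measurable_tuples_cons.
Qed.

Lemma measurable_fibre n (A : set 'rV[R]_n.+1) (t : n.-tuple mR) :
  measurable (tuples A) ->
  measurable ([set a | A (consv a (\row_i tnth t i))] : set mR).
Proof.
move=> mA; rewrite -ysection_tuples.
by apply: measurable_ysection; exact: measurable_tuples_cons.
Qed.

Lemma volume_sections n (A : set 'rV[R]_n.+1) :
  volume A = (\int[lambda]_a volume [set z | A (consv a z)])%E.
Proof. by apply: eq_integral => a _ /=; rewrite xsection_tuples. Qed.

Lemma measurable_fun_fibre n (A : set 'rV[R]_n.+1) : measurable (tuples A) ->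
  measurable_fun [set: n.-tuple mR]
    (fun t => lambda [set a | A (consv a (\row_i tnth t i))]).
Proof.
move=> mA; rewrite [X in measurable_fun _ X](_ : _ =
    lambda \o ysection (tuple_cons (R := R) (n := n) @^-1` tuples A)).
  by apply: measurable_fun_ysection; exact: measurable_tuples_cons.
by apply/funext => t /=; rewrite ysection_tuples.
Qed.

Lemma volume_fibres n (A : set 'rV[R]_n.+1) : measurable (tuples A) ->
  volume A =
  (\int[lebesgue_tuple R n]_t lambda [set a | A (consv a (\row_i tnth t i))])%E.
Proof.
move=> mA.
have -> : volume A = (lambda \x^ lebesgue_tuple R n)%E
    (tuple_cons (R := R) (n := n) @^-1` tuples A).
  apply: (@product_measure_unique _ _ _ _ _ lambda (lebesgue_tuple R n)
    (lambda \x^ lebesgue_tuple R n)%E) => //; last exact: measurable_tuples_cons.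
  by move=> B C mB mC; exact: product_measure2E.
by apply: eq_integral => t _ /=; rewrite ysection_tuples.
Qed.

(** On each slice of constant first coordinate, a shear along the other
    coordinates is a translation. *)
Lemma volume_shear n (c : 'rV[R]_n) (A : set 'rV[R]_n.+1) :
  measurable (tuples A) ->
  volume [set x : 'rV[R]_n.+1 | A (x + x 0 ord0 *: consv 0 c)] = volume A.
Proof.
move=> mA; rewrite !volume_sections; apply: eq_integral => a _.
rewrite -[RHS](volume_shift (a *: c)); last exact: measurable_tuples_section.
congr volume; apply/funext => z /=; congr A; apply/rowP => i.
case: (unliftP ord0 i) => [j|] ->.
- by rewrite mxE [(_ *: consv 0 c) _ _]mxE consv0 !consvS !mxE.
- by rewrite mxE [(_ *: consv 0 c) _ _]mxE !consv0 mulr0 addr0.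
Qed.
End volume_theory.

(** * Compact sets: measurability and finite volume *)

Section compact_sets.
Context (R : realType).
Notation lambda := (@lebesgue_measure R).
Notation mR := (measurableTypeR R).

Lemma measurable_tuples_ball n (x : 'rV[R]_n) e : 0 < e ->
  measurable (tuples (ball x e)).
Proof.
move=> e0; rewrite (_ : tuples _ = box (fun i => ball (x 0 i) e)).
  by apply: measurable_box => i; exact: measurable_ball.
apply/seteqP; split => t /=.
- by move=> [_ xt] i; have := xt 0 i; rewrite mxE.
- by move=> xt; split => // i j; rewrite ord1 mxE; exact: xt.
Qed.

(** A compact set is the intersection over k of finite unions of balls of
    radius 1/(k+1), and balls for the sup norm are boxes. *)
Lemma measurable_compact n (K : set 'rV[R]_n) :
  compact K -> measurable (tuples K).
Proof.
move=> cK; pose f k (x : 'rV[R]_n) := ball x k.+1%:R^-1.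
have k0 k : (0 : R) < k.+1%:R^-1 by rewrite invr_gt0 ltr0n.
have net k : exists D : {fset 'rV[R]_n},
    {subset D <= K} /\ K `<=` cover [set` D] (f k).
  move: (cK); rewrite compact_cover => /(_ _ K (f k)) [||D DK KD].
  - by move=> x _; exact: ball_open.
  - by move=> x Kx; exists x => //; exact: ballxx.
  - by exists D; split => // x /DK; rewrite inE => ?; rewrite inE.
have [D Dnet] := choice net.
rewrite (_ : tuples K =
    \bigcap_k \bigcup_(x in [set` D k]) tuples (f k x)).
  apply: bigcapT_measurable => k; apply: fin_bigcup_measurable => //.
  by move=> x _; exact: measurable_tuples_ball.
apply/seteqP; split => t Kt.
  by move=> k _; have [_ /(_ _ Kt) [x Dx fx]] := Dnet k; exists x.
apply: (compact_closed (@norm_hausdorff _ _) cK) => B /nbhs_ballP [e /= e0 eB].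
pose k := Num.truncn e^-1.
have [x Dx fx] := Kt k I; exists x; split.
  by have [DK _] := Dnet k; exact: set_mem (DK _ Dx).
apply: eB; apply: ball_sym; apply: le_ball fx.
by rewrite invf_ple ?posrE// ltW// truncnS_gt.
Qed.

Lemma continuous_row (T : topologicalType) n (f : T -> 'rV[R]_n) :
  (forall i, continuous (fun x => f x 0 i)) -> continuous f.
Proof.
move=> fc x B [P xP PB].
have /filterS : \forall y \near x, forall i, P 0 i (f y 0 i).
  by apply: filter_forall => i; exact: fc (xP _ _).
by apply=> y Py; apply: PB => i j; rewrite ord1; exact: Py.
Qed.

Lemma continuous_sum (T : topologicalType) n (F : 'I_n -> T -> R) :
  (forall i, continuous (F i)) -> continuous (fun x => \sum_i F i x).
Proof.
move=> cF; apply: (@continuous_big R 'I_n +%R 0 xpredT _ T) => // x.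
by apply: cvgD; [exact: cvg_fst|exact: cvg_snd].
Qed.

Lemma continuous_linear_form n (c : 'I_n -> R) :
  continuous (fun x : 'rV[R]_n => \sum_i c i * x 0 i).
Proof.
apply: continuous_sum => i x.
apply: (@cvgM R _ (nbhs x) _ (fun=> c i) (fun y : 'rV[R]_n => y 0 i)).
  exact: cvg_cst.
exact: coord_continuous.
Qed.

Lemma compact_image n (T : topologicalType) (f : T -> 'rV[R]_n) (A : set T) :
  continuous f -> compact A -> compact (f @` A).
Proof.
by move=> cf cA; apply: continuous_compact => //; exact: continuous_subspaceT.
Qed.

Definition cube n (a : R) : set 'rV[R]_n := [set x | forall i, `|x 0 i| <= a].
Arguments cube : clear implicits.

Lemma cubeE n (a : R) (x : 'rV[R]_n) :
  cube n a x <-> forall i, [set` `[- a, a]%R] (x 0 i).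
Proof. by split=> xa i; move: (xa i); rewrite /= in_itv /= -ler_norml. Qed.

Lemma compact_cube n (a : R) : compact (cube n a).
Proof.
rewrite (_ : cube n a = [set x | forall i, [set` `[- a, a]%R] (x 0 i)]).
  apply: (@rV_compact R n (fun=> [set` `[- a, a]%R])) => i.
  exact: segment_compact.
by apply/seteqP; split => x /cubeE.
Qed.

Lemma volume_cube n (a : R) : 0 <= a -> volume (cube n a) = ((2 * a) ^+ n)%:E.
Proof.
move=> a0; rewrite /volume (_ : [set t : n.-tuple mR | _] =
    [set t | forall i, [set` `[- a, a]%R] (tnth t i)]).
  rewrite [LHS](@lebesgue_tuple_box R n (fun=> [set` `[- a, a]%R])) => [|i];
    last exact: measurable_itv.
  rewrite (eq_bigr (fun=> (2 * a)%:E)) => [|i _].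
    by rewrite prodEFin prodr_const card_ord.
  rewrite lebesgue_measure_itv /= lte_fin.
  have -> : (2 * a = a + a)%R by ring.
  case: ltP => aa; first by rewrite -EFinD opprK.
  by have -> : a = 0; [lra|rewrite addr0].
by apply/seteqP; split => t /=; rewrite ?cubeE => ta i; move: (ta i) => /=;
  rewrite mxE.
Qed.

Lemma compact_sub_cube n (K : set 'rV[R]_n) : compact K ->
  exists2 a, 0 < a & K `<=` cube n a.
Proof.
move=> /compact_bounded [M [_ KM]]; exists (`|M| + 1); first by rewrite ltr_wpDl.
move=> x Kx i; have := KM (`|M| + 1) _ _ Kx.
rewrite (le_lt_trans (ler_norm _) (ltr_pwDr _ _))// => /(_ isT) /=.
by apply: le_trans; rewrite [leRHS]mx_normrE (le_bigmax _ _ (0, i)).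
Qed.

Lemma volume_fin_num n (K : set 'rV[R]_n) : compact K ->
  volume K = (fine (volume K))%:E.
Proof.
move=> cK; have [a a0 Ka] := compact_sub_cube cK.
rewrite fineK// ge0_fin_numE ?volume_ge0//.
apply: le_lt_trans (le_volume _ _ Ka) _; try exact: measurable_compact.
  by apply: measurable_compact; exact: compact_cube.
by rewrite volume_cube ?ltry// ltW.
Qed.

End compact_sets.
Arguments cube {R} n a.

(** * Adding a segment along the first axis *)

Section sweeps.
Context (R : realType).
Notation lambda := (@lebesgue_measure R).
Notation mR := (measurableTypeR R).

Definition vol n (K : set 'rV[R]_n) : R := fine (volume K).

Lemma volE n (K : set 'rV[R]_n) : compact K -> volume K = (vol K)%:E.
Proof. exact: volume_fin_num. Qed.

Lemma vol_ge0 n (K : set 'rV[R]_n) : 0 <= vol K.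
Proof. by rewrite fine_ge0 ?volume_ge0. Qed.

Lemma le_vol n (K L : set 'rV[R]_n) :
  compact K -> compact L -> K `<=` L -> vol K <= vol L.
Proof.
move=> cK cL KL; rewrite -lee_fin -!volE//.
by apply: le_volume => //; exact: measurable_compact.
Qed.

Definition cvx n (K : set 'rV[R]_n) := forall x y (a b : R),
  0 <= a -> 0 <= b -> a + b = 1 -> K x -> K y -> K (a *: x + b *: y).

Definition sweep n (w : 'rV[R]_n) (M : set 'rV[R]_n) : set 'rV[R]_n :=
  [set y | exists x c, [/\ M x, `|c| <= 1 & y = x + c *: w]].

Lemma continuous_scale_row n (w : 'rV[R]_n) :
  continuous (fun p : 'rV[R]_n * R => p.1 + p.2 *: w).
Proof.
apply: continuous_row => i p.
rewrite (_ : (fun x => _) = (fun x : 'rV[R]_n * R => x.1 0 i + x.2 * w 0 i));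
  last first.
  by apply/funext => x; rewrite !mxE.
apply: (@cvgD _ _ _ (nbhs p) _ (fun x : 'rV[R]_n * R => x.1 0 i)
  (fun x : 'rV[R]_n * R => x.2 * w 0 i)).
  apply: (@cvg_comp _ _ _ fst (fun x : 'rV[R]_n => x 0 i) _ (nbhs p.1)).
    exact: cvg_fst.
  exact: coord_continuous.
apply: (@cvgM _ _ (nbhs p) _ snd (fun=> w 0 i)); first exact: cvg_snd.
exact: cvg_cst.
Qed.

Lemma compact_sweep n (w : 'rV[R]_n) M : compact M -> compact (sweep w M).
Proof.
move=> cM; rewrite (_ : sweep w M = (fun p : 'rV[R]_n * R => p.1 + p.2 *: w) @`
   (M `*` [set` `[-1, 1]%R])).
  apply: compact_image; first exact: continuous_scale_row.
  by apply: compact_setX => //; exact: (@segment_compact R (-1) 1).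
apply/seteqP; split => y.
- move=> [x [c [Mx c1 ->]]]; exists (x, c) => //; split => //=.
  by rewrite in_itv /= -ler_norml.
- move=> [[x c] [/= Mx]]; rewrite in_itv /= -ler_norml => c1 <-.
  by exists x, c.
Qed.

Lemma sub_sweep n (w : 'rV[R]_n) M : M `<=` sweep w M.
Proof. by move=> x Mx; exists x, 0; rewrite normr0 ler01 scale0r addr0. Qed.

Lemma cvx_sweep n (w : 'rV[R]_n) M : cvx M -> cvx (sweep w M).
Proof.
move=> cM _ _ a b a0 b0 ab [x [c [Mx c1 ->]]] [y [d [My d1 ->]]].
exists (a *: x + b *: y), (a * c + b * d); split; first exact: cM.
- rewrite (le_trans (ler_normD _ _))// !normrM (ger0_norm a0) (ger0_norm b0) -ab.
  by rewrite lerD// ler_piMr.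
- by rewrite !scalerDr scalerDl !scalerA addrACA.
Qed.

Lemma cvx_linear_image m n (f : 'rV[R]_m -> 'rV[R]_n) M :
  (forall a b x y, f (a *: x + b *: y) = a *: f x + b *: f y) ->
  cvx M -> cvx (f @` M).
Proof.
move=> fl cM _ _ a b a0 b0 ab [x Mx <-] [y My <-].
by exists (a *: x + b *: y); [exact: cM|exact: fl].
Qed.

(** Every point strictly between inf F - r and sup F + r is within r of F, because
    F is an interval. *)
Lemma lebesgue_widen (F G : set mR) (r : R) : 0 <= r ->
  measurable F -> measurable G -> F !=set0 ->
  has_ubound F -> has_lbound F -> is_interval F ->
  (forall x y, F x -> `|x - y| <= r -> G y) ->
  (lambda F + (2 * r)%:E <= lambda G)%E.
Proof.
move=> r0 mF mG F0 uF lF iF FG.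
have sF : has_sup F by [].
have jF : has_inf F by [].
have infsup : inf F <= sup F.
  by have [x Fx] := F0; apply: le_trans (ge_inf lF Fx) (ub_le_sup uF Fx).
have FS : (lambda F <= (sup F - inf F)%:E)%E.
  apply: (@le_trans _ _ (lambda [set` `[inf F, sup F]%R])).
    apply: le_measure; [exact: mem_set|by apply: mem_set; exact: measurable_itv|].
    by move=> x Fx /=; rewrite in_itv /= ge_inf// ub_le_sup.
  rewrite lebesgue_measure_itv /= lte_fin; case: ltP => _; first by rewrite -EFinD.
  by rewrite lee_fin subr_ge0.
apply: (@le_trans _ _ (sup F + r - (inf F - r))%:E).
  have -> : sup F + r - (inf F - r) = sup F - inf F + 2 * r by ring.
  by rewrite EFinD leeD2r.
apply: (@le_trans _ _ (lambda [set` `]inf F - r, sup F + r[%R])).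
  rewrite lebesgue_measure_itv /= lte_fin; case: ltP => h; first by rewrite -EFinD.
  by rewrite lee_fin subr_le0.
apply: le_measure; [by apply: mem_set; exact: measurable_itv|exact: mem_set|].
move=> y /=; rewrite in_itv /= => /andP[iy ys].
have [a Fa ay] : exists2 a, F a & a < y + r.
  by apply: inf_lt => //; rewrite -ltrBlDr.
have [b Fb yb] : exists2 b, F b & y - r < b.
  by apply: sup_gt => //; rewrite ltrBlDr.
have [ya|ya] := leP (y - r) a.
  by apply: (FG a) => //; rewrite ler_norml; apply/andP; split; lra.
apply: (FG (y - r)); first by apply: (iF a b) => //; rewrite (ltW ya) (ltW yb).
by rewrite addrAC subrr sub0r normrN ger0_norm.
Qed.

(** By Fubini over the lines parallel to the first axis: each nonempty fibre is an
    interval, and the sweep lengthens it by 2|r|. *)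
Lemma vol_sweep_axis n (r : R) (M : set 'rV[R]_n.+1) P :
  compact M -> cvx M -> compact P ->
  P = [set z : 'rV[R]_n | exists a, M (consv a z)] ->
  vol M + 2 * `|r| * vol P <= vol (sweep (consv r 0) M).
Proof.
move=> cM vM cP PE.
have mM := measurable_compact cM.
have mP := measurable_compact cP.
have cS := compact_sweep (w := consv r 0) cM.
have mS := measurable_compact cS.
rewrite -lee_fin EFinD EFinM -!volE// (volume_fibres mM) (volume_fibres mS).
have -> : volume P = (\int[lebesgue_tuple R n]_t (\1_(tuples P) t)%:E)%E.
  by rewrite integral_indic// setIT.
have mI : measurable_fun [set: n.-tuple mR]
    (fun t => (\1_(tuples P) t)%:E : \bar R).
  by apply/measurable_EFinP; exact: measurable_indic.
have r0 : (0 <= (2 * `|r|)%:E)%E by rewrite lee_fin mulr_ge0.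
have I0 t : (0 <= (\1_(tuples P) t)%:E :> \bar R)%E by rewrite lee_fin.
rewrite -(ge0_integralZl _ measurableT mI (fun t _ => I0 t) r0).
have mF := measurable_fun_fibre mM.
have mrI : measurable_fun [set: n.-tuple mR]
    (fun t => (2 * `|r|)%:E * (\1_(tuples P) t)%:E : \bar R)%E.
  exact: measurable_funeM.
have rI0 t : [set: n.-tuple mR] t ->
  (0 <= (2 * `|r|)%:E * (\1_(tuples P) t)%:E :> \bar R)%E.
  by rewrite mule_ge0.
have F0 t : [set: n.-tuple mR] t ->
  (0 <= lambda [set a | M (consv a (\row_i tnth t i))])%E by [].
rewrite -(ge0_integralD _ measurableT F0 mF rI0 mrI).
apply: ge0_le_integral => //.
- by move=> t _; rewrite adde_ge0// mule_ge0.
- exact: emeasurable_funD.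
- exact: measurable_fun_fibre.
move=> t _; set z := \row_i tnth t i.
have [Pz|Pz] := pselect (P z); last first.
  rewrite indicE memNset// mule0 adde0.
  rewrite (_ : [set a | M (consv a z)] = set0) ?measure0//.
  by apply/seteqP; split => // a Ma; apply: Pz; rewrite PE; exists a.
rewrite indicE mem_set// mule1.
have [b b0 Mb] := compact_sub_cube cM.
have Fb a : M (consv a z) -> `|a| <= b.
  by move=> /Mb /(_ ord0); rewrite consv0.
apply: lebesgue_widen => //.
- exact: measurable_fibre.
- exact: measurable_fibre.
- by move: Pz; rewrite PE => -[a Ma]; exists a.
- by exists b => a /Fb; apply: le_trans; exact: ler_norm.
- by exists (- b) => a /Fb; rewrite ler_norml => /andP[].
- move=> x y /= Mx My a /andP[xa ay].
  have [xy|xy] := eqVneq x y.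
    by have <- : x = a by apply/eqP; rewrite eq_le xa xy ay.
  have yx : 0 < y - x by rewrite subr_gt0 lt_neqAle xy (le_trans xa ay).
  have -> : consv a z =
      ((y - a) / (y - x)) *: consv x z + ((a - x) / (y - x)) *: consv y z.
    apply/rowP => i; rewrite [RHS]mxE ![(_ *: consv _ _) _ _]mxE.
    case: (unliftP ord0 i) => [j|] ->; rewrite ?consv0 ?consvS.
    + by field; exact: lt0r_neq0.
    + by field; exact: lt0r_neq0.
  apply: vM => //.
  + by rewrite divr_ge0 ?subr_ge0// ltW// -subr_gt0.
  + by rewrite divr_ge0 ?subr_ge0// ltW// -subr_gt0.
  + by field; exact: lt0r_neq0.
- move=> x y /= Mx xy.
  have [r00|r00] := eqVneq r 0.
    have -> : y = x by apply/esym; move: xy;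
      rewrite r00 normr0 normr_le0 subr_eq0 => /eqP.
    exact: sub_sweep.
  exists (consv x z), ((y - x) / r); split => //.
    by rewrite normrM normfV ler_pdivrMr ?normr_gt0// mul1r distrC.
  apply/rowP => i; rewrite [RHS]mxE [(_ *: consv _ _) _ _]mxE.
  case: (unliftP ord0 i) => [j|] ->; rewrite ?consv0 ?consvS.
  + by rewrite [X in _ * X]mxE mulr0 addr0.
  + by field.
Qed.
End sweeps.

(** * Zonotopes inside a convex body *)

Section mixed_volume.
Context (R : realType).
Implicit Types n : nat.

(** The projection along w onto the coordinate hyperplane x_i = 0, read in the
    n remaining coordinates. *)
Definition proj_along n (i : 'I_n.+1) (w x : 'rV[R]_n.+1) : 'rV[R]_n :=
  \row_k (x 0 (lift i k) - x 0 i / w 0 i * w 0 (lift i k)).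

Lemma proj_linear n i (w : 'rV[R]_n.+1) a b x y :
  proj_along i w (a *: x + b *: y) = a *: proj_along i w x + b *: proj_along i w y.
Proof. by apply/rowP => k; rewrite !mxE; ring. Qed.

Lemma continuous_proj n i (w : 'rV[R]_n.+1) : continuous (proj_along i w).
Proof.
apply: continuous_row => k.
rewrite (_ : (fun x => _) = (fun x : 'rV[R]_n.+1 => \sum_j
    ((j == lift i k)%:R - (j == i)%:R / w 0 i * w 0 (lift i k)) * x 0 j)).
  exact: continuous_linear_form.
apply/funext => x; rewrite mxE (bigD1 (lift i k)) //= (bigD1 i) ?neq_lift//=.
rewrite big1 => [|j /andP[/negPf -> /negPf ->]]; last by rewrite !mul0r subr0 mul0r.
rewrite !eqxx (negPf (neq_lift i k)) eq_sym (negPf (neq_lift i k)) /=.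
by rewrite !mul0r subr0 mul1r addr0 sub0r mul1r mulNr; congr (_ - _); ring.
Qed.

Lemma compact_proj n i (w : 'rV[R]_n.+1) K :
  compact K -> compact (proj_along i w @` K).
Proof. by apply: compact_image; exact: continuous_proj. Qed.

Lemma cvx_proj n i (w : 'rV[R]_n.+1) K : cvx K -> cvx (proj_along i w @` K).
Proof. by apply: cvx_linear_image; exact: proj_linear. Qed.

(** The linear change of coordinates that turns w into a multiple of the first
    basis vector, and [proj_along] into forgetting the first coordinate. *)
Let straighten n (i : 'I_n.+1) (w x : 'rV[R]_n.+1) :=
  consv (x 0 i) (proj_along i w x).

Let straighten_linear n i (w x y : 'rV[R]_n.+1) a b :
  straighten i w (a *: x + b *: y) = a *: straighten i w x + b *: straighten i w y.
Proof.
apply/rowP => j; rewrite [RHS]mxE ![(_ *: straighten _ _ _) _ _]mxE /straighten.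
case: (unliftP ord0 j) => [k|] ->; rewrite ?consvS ?consv0 ?proj_linear !mxE//.
Qed.

Let compact_straighten n i (w : 'rV[R]_n.+1) K :
  compact K -> compact (straighten i w @` K).
Proof.
apply: compact_image; apply: continuous_row => j.
case: (unliftP ord0 j) => [k|] ->.
  rewrite (_ : (fun x => _) = (fun x : 'rV[R]_n.+1 => proj_along i w x 0 k)).
    move=> x; apply: (@cvg_comp _ _ _ (proj_along i w) (fun z : 'rV[R]_n => z 0 k) _
      (nbhs (proj_along i w x))); [exact: continuous_proj|exact: coord_continuous].
  by apply/funext => x; rewrite /straighten consvS.
rewrite (_ : (fun x => _) = (fun x : 'rV[R]_n.+1 => x 0 i)).
  exact: coord_continuous.
by apply/funext => x; rewrite /straighten consv0.
Qed.

Let vol_straighten n i (w : 'rV[R]_n.+1) K :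
  compact K -> vol (straighten i w @` K) = vol K.
Proof.
move=> cK; pose s : 'S_n.+1 := lift_perm ord0 i 1%g.
pose c : 'rV[R]_n := \row_k (- (w 0 (lift i k) / w 0 i)).
have sE x : straighten i w x =
    col_perm s x + col_perm s x 0 ord0 *: consv 0 c.
  apply/rowP => j; rewrite [RHS]mxE [(_ *: consv _ _) _ _]mxE !mxE.
  case: (unliftP ord0 j) => [k|] ->.
    rewrite /s lift_perm_lift lift_perm_id perm1 /= !mxE.
    by ring.
  by rewrite /= lift_perm_id mulr0 addr0.
have cS := @compact_straighten n i w K cK.
have cP : compact ((col_perm s : 'rV[R]_n.+1 -> 'rV[R]_n.+1) @` K).
  apply: compact_image => //; apply: continuous_row => j.
  rewrite (_ : (fun x => _) = (fun x : 'rV[R]_n.+1 => x 0 (s j))).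
    exact: coord_continuous.
  by apply/funext => x; rewrite mxE.
congr fine; rewrite -(volume_shear c (measurable_compact cS)).
have -> : [set x : 'rV[R]_n.+1 |
    (straighten i w @` K) (x + x 0 ord0 *: consv 0 c)] =
    (col_perm s : 'rV[R]_n.+1 -> 'rV[R]_n.+1) @` K.
  apply/seteqP; split => y /=.
    move=> [x Kx xy]; exists x => //; move: xy; rewrite sE => xy.
    have xy0 : col_perm s x 0 ord0 = y 0 ord0.
      have := congr1 (fun z : 'rV[R]_n.+1 => z 0 ord0) xy.
      rewrite /= [X in X = _]mxE [X in _ = X]mxE ![(_ *: consv _ _) _ _]mxE.
      by rewrite !consv0 !mulr0 !addr0.
    by move: xy; rewrite xy0 => /addIr.
  by move=> [x Kx <-]; exists x.
rewrite -(volume_perm s (measurable_compact cP)); congr volume.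
apply/seteqP; split => x /=; last by move=> Kx; exists x.
move=> [y Ky yx]; suff <- : y = x by [].
by apply/rowP => j; have := congr1 (fun z : 'rV[R]_n.+1 => z 0 ((s^-1)%g j)) yx;
  rewrite /= !mxE permKV.
Qed.

(** The chords of M parallel to w are measured by their i-th coordinate, so that
    the sweep lengthens each of them by 2|w_i|. *)
Lemma vol_sweep n i (w : 'rV[R]_n.+1) (M : set 'rV[R]_n.+1) :
  w 0 i != 0 -> compact M -> cvx M ->
  vol M + 2 * `|w 0 i| * vol (proj_along i w @` M) <= vol (sweep w M).
Proof.
move=> wi cM vM; rewrite -(@vol_straighten n i w M cM).
have sw : straighten i w w = consv (w 0 i) 0.
  apply/rowP => j; case: (unliftP ord0 j) => [k|] ->;
    rewrite /straighten ?consv0 // !consvS.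
  by rewrite !mxE divff// mul1r subrr.
have -> : vol (sweep w M) = vol (sweep (consv (w 0 i) 0) (straighten i w @` M)).
  rewrite -(@vol_straighten n i w _ (compact_sweep (w := w) cM)); congr vol.
  have sl x c : straighten i w (x + c *: w) =
      straighten i w x + c *: consv (w 0 i) 0.
    by have := straighten_linear i w x w 1 c; rewrite !scale1r sw.
  apply/seteqP; split => y.
    by move=> [_ [x [c [Mx c1 ->]]] <-]; exists (straighten i w x), c;
      split => //; exists x.
  move=> [_ [c [[x Mx <-] c1 ->]]]; exists (x + c *: w); last exact: sl.
  by exists x, c.
apply: vol_sweep_axis.
- exact: compact_straighten.
- by apply: cvx_linear_image => // *; exact: straighten_linear.
- exact: compact_proj.
apply/seteqP; split => z /=.
  by move=> [x Mx <-]; exists (x 0 i), x.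
move=> [a [x Mx xz]]; exists x => //; apply/rowP => k.
have := congr1 (fun z : 'rV[R]_n.+1 => z 0 (lift ord0 k)) xz.
by rewrite /= /straighten !consvS.
Qed.

(** The sum of L and of the segments [-w, w].  Each w comes with a coordinate i such
    that w_i <> 0, by which the chords parallel to w are measured. *)
Definition sweeps n (ws : seq ('I_n.+1 * 'rV[R]_n.+1)) (L : set 'rV[R]_n.+1) :=
  foldr (fun iw => sweep iw.2) L ws.

Lemma vol_sweeps n (ws : seq ('I_n.+1 * 'rV[R]_n.+1)) L :
  (forall iw, iw \in ws -> iw.2 0 iw.1 != 0) -> compact L -> cvx L ->
  [/\ compact (sweeps ws L), cvx (sweeps ws L), L `<=` sweeps ws L &
    vol L + \sum_(iw <- ws) 2 * `|iw.2 0 iw.1| * vol (proj_along iw.1 iw.2 @` L)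
      <= vol (sweeps ws L)].
Proof.
move=> + cL vL; elim: ws => [|[i w] ws IH] wsP /=; first by split;
  rewrite ?big_nil ?addr0.
have [|cS vS LS volS] := IH; first by move=> iw ws_iw; apply: wsP;
  rewrite inE ws_iw orbT.
split.
- exact: compact_sweep.
- exact: cvx_sweep.
- by apply: subset_trans LS _; exact: sub_sweep.
rewrite big_cons /= addrCA; have := wsP (i, w); rewrite inE eqxx => /(_ isT) /= wi.
apply: le_trans (vol_sweep wi cS vS); rewrite addrC lerD// ler_wpM2l//.
apply: le_vol; [exact: compact_proj|exact: compact_proj|].
by move=> _ [x Lx <-]; exists x => //; exact: LS.
Qed.

Lemma compact_scale n (c : R) (L : set 'rV[R]_n) : compact L ->
  compact ((fun x => c *: x) @` L).
Proof.
apply: compact_image; apply: continuous_row => i.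
rewrite (_ : (fun x => _) = (fun x : 'rV[R]_n => \sum_j (c *+ (j == i)) * x 0 j)).
  exact: continuous_linear_form.
apply/funext => x; rewrite mxE (bigD1 i)//= eqxx big1 ?addr0// => j /negPf ->.
by rewrite mul0r.
Qed.

Lemma vol_scale n (c : R) (L : set 'rV[R]_n) : 0 < c -> compact L ->
  vol ((fun x => c *: x) @` L) = c ^+ n * vol L.
Proof.
move=> c0 cL; have ci0 : 0 < c^-1 by rewrite invr_gt0.
have -> : (fun x => c *: x) @` L = [set x | L (c^-1 *: x)].
  apply/seteqP; split => y /=.
    by move=> [x Lx <-]; rewrite scalerA mulVf ?lt0r_neq0// scale1r.
  by move=> Ly; exists (c^-1 *: y) => //;
    rewrite scalerA mulfV ?lt0r_neq0// scale1r.
by rewrite /vol volume_scale ?invrK//; [rewrite volE|exact: measurable_compact].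
Qed.

Lemma sweeps_scale n (ws : seq ('I_n.+1 * 'rV[R]_n.+1)) L (t : R) y :
  sweeps [seq (iw.1, t *: iw.2) | iw <- ws] L y ->
  exists x z, [/\ L x, sweeps ws [set 0] z & y = x + t *: z].
Proof.
elim: ws y => [|[i w] ws IH] y /=.
  by move=> Ly; exists y, 0; rewrite scaler0 addr0.
move=> [y' [c [/IH [x [z [Lx wz ->]]] c1 ->]]].
exists x, (z + c *: w); split => //; first by exists z, c.
by rewrite scalerDr addrA !scalerA mulrC.
Qed.

(** The first-order expansion in t of vol (L + tZ) <= (1 + t)^n vol L, where the
    zonotope Z, the sum of the segments [-w, w], lies in L. *)
Theorem zonotope_volume n (ws : seq ('I_n.+1 * 'rV[R]_n.+1)) L :
  (forall iw, iw \in ws -> iw.2 0 iw.1 != 0) -> compact L -> cvx L ->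
  sweeps ws [set 0] `<=` L ->
  \sum_(iw <- ws) 2 * `|iw.2 0 iw.1| * vol (proj_along iw.1 iw.2 @` L)
    <= n.+1%:R * vol L.
Proof.
move=> wsP cL vL wsL; set S := \sum_(iw <- ws) _; set V := vol L.
have V0 : 0 <= V by exact: vol_ge0.
have St (t : R) : 0 < t -> V + t * S <= (1 + t) ^+ n.+1 * V.
  move=> t0; have t1 : 0 < 1 + t by lra.
  pose tws := [seq (iw.1, t *: iw.2) | iw <- ws].
  have [|cS _ _ volS] := @vol_sweeps n tws L _ cL vL.
    by move=> _ /mapP [iw wsw ->] /=; rewrite mxE; apply: mulf_neq0;
      [exact: lt0r_neq0|exact: wsP].
  apply: (@le_trans _ _ (vol (sweeps tws L))).
    apply: le_trans volS; rewrite lerD2l /S mulr_sumr big_map.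
    rewrite le_eqVlt; apply/orP; left; apply/eqP; apply: eq_bigr => -[i w] _ /=.
    have -> : proj_along i (t *: w) = proj_along i w.
      apply/funext => x; apply/rowP => k; rewrite !mxE invfM.
      have [->|w0] := eqVneq (w 0 i) 0; first by rewrite invr0 !mulr0 !mul0r.
      by congr (_ - _); field; rewrite w0 lt0r_neq0.
    by rewrite mxE normrM gtr0_norm//; ring.
  rewrite /V -vol_scale//; apply: le_vol => //; first exact: compact_scale.
  move=> _ /sweeps_scale [x [z [Lx /wsL Lz ->]]].
  exists ((1 + t)^-1 *: x + (t / (1 + t)) *: z).
    apply: vL => //.
    - by rewrite invr_ge0 ltW.
    - by apply: divr_ge0; exact: ltW.
    - by field; exact: lt0r_neq0.
  rewrite scalerDr !scalerA mulfV ?lt0r_neq0// scale1r mulrCA mulfV ?lt0r_neq0//.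
  by rewrite mulr1.
(* The constant 4^m leaves room for the induction; only the order of the error in t
   matters. *)
have pow (t : R) m : 0 <= t -> t <= 1 ->
    (1 + t) ^+ m <= 1 + m%:R * t + 4 ^+ m * t ^+ 2.
  move=> t0 t1; elim: m => [|m IH];
    first by rewrite !expr0 mul0r mul1r addr0 lerDl; nra.
  rewrite exprS; apply: le_trans (ler_wpM2l _ IH) _; first by lra.
  have m4 : m%:R <= 4 ^+ m :> R.
    by rewrite -natrX ler_nat ltnW// ltn_expl.
  have c0 : 0 <= 4 ^+ m :> R by exact: exprn_ge0.
  rewrite [4 ^+ m.+1]exprS -[m.+1%:R]natr1; move: m4 c0.
  move: (4 ^+ m) (m%:R) => c k kc c0; rewrite !expr2.
  have : 0 <= t * t by rewrite mulr_ge0.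
  set q := t * t => q0.
  have : k * q <= c * q by rewrite ler_wpM2r.
  have : c * q * t <= c * q by rewrite ler_piMr// mulr_ge0.
  have : 0 <= c * q by rewrite mulr_ge0.
  have -> : (1 + t) * (1 + k * t + c * q) =
    1 + k * t + c * q + t + k * q + c * q * t by rewrite /q; ring.
  lra.
apply/ler_addgt0Pr => e e0; set C : R := 4 ^+ n.+1.
have C0 : 0 <= C by exact: exprn_ge0.
have CV0 : 0 < C * V + 1 by rewrite ltr_wpDl// mulr_ge0.
(* The quadratic error C V t^2, divided by t, has to be at most e. *)
pose t := Num.min 1 (e / (C * V + 1)).
have t0 : 0 < t by rewrite lt_min ltr01 divr_gt0.
have t1 : t <= 1 by rewrite ge_min lexx.
have te : t * (C * V + 1) <= e by rewrite -ler_pdivlMr// ge_min lexx orbT.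
have h := le_trans (St t t0) (ler_wpM2r V0 (pow t n.+1 (ltW t0) t1)).
rewrite -(ler_pM2l t0).
have : t * (t * (C * V + 1)) <= t * e by rewrite ler_pM2l.
have : 0 <= t * t by rewrite mulr_ge0 ?ltW.
move: h; rewrite -/C; nra.
Qed.
End mixed_volume.

(** * Averaging over signed permutations *)

Section symmetry.
Context (R : realType).
Implicit Types n : nat.

Definition signed_perm n (s : 'S_n) (e : 'I_n -> bool) (x : 'rV[R]_n) : 'rV[R]_n :=
  \row_j ((-1) ^+ e j * x 0 (s j)).

Definition hyperoctahedral_inv n (K : set 'rV[R]_n) :=
  forall s e x, K x -> K (signed_perm s e x).

(** A signed permutation matrix has for determinant the sign of the permutation
    times the product of its nonzero entries. *)
Definition rotation_inv n (K : set 'rV[R]_n) :=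
  forall (s : 'S_n) e x, \big[addb/false]_j e j = s -> K x -> K (signed_perm s e x).

Lemma hyperoctahedral_rotation_inv n (K : set 'rV[R]_n) :
  hyperoctahedral_inv K -> rotation_inv K.
Proof. by move=> iK s e x _; exact: iK. Qed.

Lemma cvx_mean n (K : set 'rV[R]_n) (I : finType) (P : {pred I})
    (f : I -> 'rV[R]_n) : cvx K -> (0 < #|P|)%N -> (forall i, i \in P -> K (f i)) ->
  K (#|P|%:R^-1 *: \sum_(i in P) f i).
Proof.
move=> vK P0 Kf; rewrite -big_enum cardE.
have : (0 < size (enum P))%N by rewrite -cardE.
have : {in enum P, forall i, K (f i)} by move=> i; rewrite mem_enum; exact: Kf.
elim: (enum P) => // i s IH sf _ /=.
have Kfi : K (f i) by apply: sf; rewrite inE eqxx.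
have [->|s0] := eqVneq s [::]; first by rewrite big_seq1 invr1 scale1r.
have s1 : (0 < size s)%N by rewrite lt0n size_eq0.
have s2 : (size s)%:R != 0 :> R by rewrite pnatr_eq0 -lt0n.
have s3 : (size s).+1%:R != 0 :> R by rewrite pnatr_eq0.
rewrite big_cons scalerDr.
have -> : (size s).+1%:R^-1 *: \sum_(j <- s) f j = ((size s)%:R / (size s).+1%:R) *:
    ((size s)%:R^-1 *: \sum_(j <- s) f j).
  by rewrite scalerA mulrAC mulfV// mul1r.
apply: vK => //.
- by rewrite -natr1; field; rewrite natr1.
- by apply: IH => // j js; apply: sf; rewrite inE js orbT.
Qed.

Definition transitive_left n (P : {set 'S_n}) := forall i j, exists h : 'S_n,
  h i = j /\ forall s, ((h * s)%g \in P) = (s \in P).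

(** Left translation by h turns the values at i into the values at h i, so the sum
    does not depend on i, and it equals its mean over i. *)
Lemma sum_perm_mean n (P : {set 'S_n}) (f : 'I_n -> R) i :
  transitive_left P ->
  \sum_(s in P) f (s i) = #|P|%:R / n%:R * \sum_j f j.
Proof.
move=> tP; have n0 : n%:R != 0 :> R.
  by rewrite pnatr_eq0 -lt0n (leq_ltn_trans _ (ltn_ord i)).
have eq_i j : \sum_(s in P) f (s j) = \sum_(s in P) f (s i).
  have [h [hij hP]] := tP i j; rewrite [RHS](reindex_inj (mulgI h)) /=.
  by apply: eq_big => [s|s _]; rewrite ?hP// permM hij.
have : \sum_j \sum_(s in P) f (s j) = #|P|%:R * \sum_j f j.
  rewrite exchange_big /= (eq_bigr (fun=> \sum_j f j)) => [|s _].
    by rewrite sumr_const mulr_natl.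
  by rewrite [RHS](reindex_inj (@perm_inj _ s)).
rewrite (eq_bigr _ (fun j _ => eq_i j)) sumr_const card_ord => h.
by apply: (mulfI n0); rewrite [LHS]mulr_natl h; field.
Qed.

Lemma transitive_leftT n : transitive_left [set: 'S_n]%SET.
Proof. by move=> i j; exists (tperm i j); split=> [|s]; rewrite ?tpermL ?inE. Qed.

Lemma transitive_left_parity n (b : bool) : (3 <= n)%N ->
  transitive_left [set s : 'S_n | odd_perm s == b]%SET.
Proof.
move=> n3 i j; have [<-|ij] := eqVneq i j.
  by exists 1%g; split=> [|s]; rewrite ?perm1 ?mul1g.
have /existsP[k /norP[ki kj]] : [exists k, ~~ ((k == i) || (k == j))].
  rewrite -negb_forall; apply/negP => /forallP all2.
  have : (n <= #|[set i; j]%SET|)%N.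
    rewrite -[leqLHS]card_ord -cardsT subset_leq_card//.
    by apply/fintype.subsetP => k _; rewrite !inE all2.
  by rewrite cards2 ij => /(leq_trans n3).
exists (tperm i k * tperm k j)%g; split; first by rewrite permM tpermL tpermL.
by move=> s; rewrite !inE !odd_permM !odd_tperm (eq_sym i k) ki kj.
Qed.

Lemma card_parity n (b : bool) : (2 <= n)%N ->
  (0 < #|[set s : 'S_n | odd_perm s == b]%SET|)%N.
Proof.
case: n => [|[|n]]// _; apply/card_gt0P; case: b.
  by exists (tperm ord0 (lift ord0 ord0)); rewrite inE odd_tperm.
by exists 1%g; rewrite inE odd_perm1.
Qed.

Lemma sign_norm (a : R) : (-1) ^+ (a < 0)%R * a = `|a|.
Proof.
case: (ltP a 0) => a0; first by rewrite expr1 mulN1r ltr0_norm.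
by rewrite expr0 mul1r ger0_norm.
Qed.

(** The mean of the points with coordinates (-1)^(e_j) |x_(s j)| over the
    permutations s.  The determinant 1 prescribes the parity of s, and the
    permutations of one parity still suffice for [sum_perm_mean] if n >= 3. *)
Lemma mean_vertex n (K : set 'rV[R]_n) x (e : 'I_n -> bool) : cvx K ->
  hyperoctahedral_inv K \/ (3 <= n)%N /\ rotation_inv K -> K x ->
  K (\row_j ((-1) ^+ e j * ((\sum_i `|x 0 i|) / n%:R))).
Proof.
move=> vK iK Kx; pose d (s : 'S_n) j := e j (+) (x 0 (s j) < 0)%R.
pose b := (\big[addb/false]_j e j) (+) \big[addb/false]_j (x 0 j < 0)%R.
have bigd s : \big[addb/false]_j d s j = b.
  rewrite big_split /=; congr addb.
  by rewrite [RHS](reindex_inj (@perm_inj _ s)).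
have [P [P0 tP KP]] : exists P : {set 'S_n}, [/\ (0 < #|P|)%N, transitive_left P &
    forall s, s \in P -> K (signed_perm s (d s) x)].
  case: iK => [iK|[n3 iK]].
    exists [set: 'S_n]%SET; split; last by move=> s _; exact: iK.
    - by apply/card_gt0P; exists 1%g.
    - exact: transitive_leftT.
  exists [set s : 'S_n | odd_perm s == b]%SET; split.
  - by apply: card_parity; exact: ltnW.
  - exact: transitive_left_parity.
  - by move=> s; rewrite inE => /eqP sb; apply: iK => //; rewrite bigd sb.
have := cvx_mean vK P0 KP; congr K; apply/rowP => j.
rewrite !mxE summxE (eq_bigr (fun s : 'S_n => (-1) ^+ e j * `|x 0 (s j)|)) =>
  [|s _].
  rewrite -mulr_sumr (sum_perm_mean (fun i => `|x 0 i|) j tP).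
  have : #|P|%:R != 0 :> R by rewrite pnatr_eq0 -lt0n.
  have : n%:R != 0 :> R by rewrite pnatr_eq0 -lt0n (leq_ltn_trans _ (ltn_ord j)).
  by move=> n0 p0; field; rewrite n0 p0.
by rewrite mxE /d signr_addb -mulrA sign_norm.
Qed.

(** Starting from the vertices, the coordinates are moved into [-m, m] one at a
    time: the set of the points whose first k coordinates are arbitrary is reached
    by interpolating in the k-th coordinate. *)
Lemma cube_of_vertices n (K : set 'rV[R]_n) (m : R) : cvx K ->
  (forall e : 'I_n -> bool, K (\row_j ((-1) ^+ e j * m))) ->
  cube n m `<=` K.
Proof.
move=> vK Kv y ym.
suff Kk k (z : 'rV[R]_n) : (forall i : 'I_n, (i < k)%N -> `|z 0 i| <= m) ->
    (forall i : 'I_n, (k <= i)%N -> `|z 0 i| = m) -> K z.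
  by apply: (Kk n y) => i; [move=> _; exact: ym|rewrite leqNgt ltn_ord].
elim: k z => [|k IH] z zm zk.
  rewrite (_ : z = \row_j ((-1) ^+ (z 0 j < 0)%R * m)); first exact: Kv.
  apply/rowP => j; rewrite mxE -(zk j)// -sign_norm mulrA -signr_addb addbb.
  by rewrite mul1r.
have [kn|nk] := ltnP k n; last first.
  apply: IH => i; first by move=> ik; apply: zm; exact: ltnW.
  by move=> ki; have := leq_trans (leq_trans nk ki) (ltnW (ltn_ord i));
    have := ltn_ord i; lia.
pose i0 := Ordinal kn; have zi0 : `|z 0 i0| <= m by apply: zm => /=.
pose set_ (c : R) : 'rV[R]_n := \row_j (if j == i0 then c else z 0 j).
have Kset c : `|c| = m -> K (set_ c).
  move=> cm; apply: IH => i ik; rewrite mxE; case: eqP => [|/eqP ii0].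
  - by rewrite cm.
  - by apply: zm; exact: ltnW.
  - by rewrite cm.
  - by apply: zk; rewrite ltn_neqAle ik andbT eq_sym;
    apply: contraNneq ii0 => ?; apply/eqP/val_inj.
have m0 : 0 <= m by apply: le_trans zi0.
have [m00|m00] := eqVneq m 0.
  rewrite (_ : z = set_ 0); first by apply: Kset; rewrite normr0.
  apply/rowP => j; rewrite mxE; case: eqP => [->|//].
  by apply/eqP; rewrite -normr_le0 -m00.
have mp : 0 < m by rewrite lt_neqAle eq_sym m00.
have -> : z = ((m + z 0 i0) / (2 * m)) *: set_ m +
  ((m - z 0 i0) / (2 * m)) *: set_ (- m).
  by apply/rowP => j; rewrite !mxE; case: eqP => [->|_]; field.
have /andP[zl zu] : - m <= z 0 i0 <= m by rewrite -ler_norml.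
apply: vK.
- by apply: divr_ge0; lra.
- by apply: divr_ge0; lra.
- by field.
- by apply: Kset; exact: ger0_norm.
- by apply: Kset; rewrite normrN; exact: ger0_norm.
Qed.

Lemma mean_cube n (K : set 'rV[R]_n) x : cvx K ->
  hyperoctahedral_inv K \/ (3 <= n)%N /\ rotation_inv K -> K x ->
  cube n ((\sum_i `|x 0 i|) / n%:R) `<=` K.
Proof.
by move=> vK iK Kx; apply: cube_of_vertices => // e; exact: mean_vertex.
Qed.

End symmetry.

(** * Induction on the dimension *)

Section polar_bodies.
Context (R : realType).
Implicit Types n : nat.

Lemma dotvC n (x y : 'rV[R]_n) : dotv x y = dotv y x.
Proof. by apply: eq_bigr => i _; rewrite mulrC. Qed.

Lemma dotv_linear n (x y z : 'rV[R]_n) a b :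
  dotv (a *: x + b *: y) z = a * dotv x z + b * dotv y z.
Proof.
rewrite /dotv !mulr_sumr -big_split /=; apply: eq_bigr => i _.
by rewrite !mxE; ring.
Qed.

Lemma dotv_delta n (x : 'rV[R]_n) a i : dotv x (a *: delta_mx 0 i) = a * x 0 i.
Proof.
rewrite /dotv (bigD1 i)//= big1 ?addr0 => [|j /negPf ji].
  by rewrite !mxE !eqxx mulr1 mulrC.
by rewrite !mxE ji andbF mulr0 mulr0.
Qed.

Lemma cvx_polar n (K : set 'rV[R]_n) : cvx (polar K).
Proof.
move=> x y a b a0 b0 ab Kx Ky z Kz; rewrite dotv_linear -ab lerD//.
  by rewrite ler_piMr// Kx.
by rewrite ler_piMr// Ky.
Qed.

Lemma cube_delta n (m a : R) (i : 'I_n) : `|a| <= m -> cube n m (a *: delta_mx 0 i).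
Proof.
move=> am j; rewrite !mxE eqxx /=; case: eqP => _; rewrite ?mulr1// mulr0 normr0.
exact: le_trans am.
Qed.

Lemma polar_sub_cube n (K : set 'rV[R]_n) m : 0 < m -> cube n m `<=` K ->
  polar K `<=` cube n m^-1.
Proof.
move=> m0 mK y Ky i; rewrite -[m^-1]mul1r ler_pdivlMr// -{1}(gtr0_norm m0) -normrM.
rewrite mulrC ler_norml; apply/andP; split.
  rewrite lerNl -mulNr -dotv_delta; apply/Ky/mK/cube_delta.
  by rewrite normrN gtr0_norm.
by rewrite -dotv_delta; apply/Ky/mK/cube_delta; rewrite gtr0_norm.
Qed.

Lemma closed_polar n (K : set 'rV[R]_n) : closed (polar K).
Proof.
rewrite (_ : polar K =
    \bigcap_(x in K) ((fun y => dotv y x) @^-1` [set r | r <= 1])); last first.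
  by apply/seteqP; split.
apply: closed_bigI => x _; apply: closed_comp; last exact: closed_le.
move=> y _; rewrite (_ : (fun y => dotv y x) = (fun y => \sum_i x 0 i * y 0 i)).
  exact: continuous_linear_form.
by apply/funext => z; rewrite dotvC.
Qed.

Lemma compact_polar n (K : set 'rV[R]_n) m : 0 < m -> cube n m `<=` K ->
  compact (polar K).
Proof.
move=> m0 mK; apply: (@subclosed_compact _ _ (cube n m^-1)).
- exact: closed_polar.
- exact: compact_cube.
- exact: polar_sub_cube.
Qed.

Lemma cube_sub_polar n (K : set 'rV[R]_n) b :
  (forall x, K x -> b * \sum_i `|x 0 i| <= 1) -> cube n b `<=` polar K.
Proof.
move=> Kb y yb x /Kb; apply: le_trans; rewrite mulr_sumr; apply: ler_sum => i _.
by rewrite (le_trans (ler_norm _))// normrM ler_wpM2r.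
Qed.

(** The inclusion of the coordinate hyperplane x_i = 0. *)
Definition ins n (i : 'I_n.+1) (y : 'rV[R]_n) : 'rV[R]_n.+1 :=
  \row_j oapp (y 0) 0 (unlift i j).

Lemma ins_same n i (y : 'rV[R]_n) : ins i y 0 i = 0.
Proof. by rewrite mxE unlift_none. Qed.

Lemma ins_lift n i (y : 'rV[R]_n) k : ins i y 0 (lift i k) = y 0 k.
Proof. by rewrite mxE liftK. Qed.

Definition drop_coord n (i : 'I_n.+1) (x : 'rV[R]_n.+1) : 'rV[R]_n :=
  \row_k x 0 (lift i k).

Lemma drop_ins n i (y : 'rV[R]_n) : drop_coord i (ins i y) = y.
Proof. by apply/rowP => k; rewrite mxE ins_lift. Qed.

Lemma proj_delta n i a : proj_along i (a *: (delta_mx 0 i : 'rV[R]_n.+1)) =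
  @drop_coord n i.
Proof.
apply/funext => x; apply/rowP => k; rewrite !mxE eqxx /=.
by rewrite [lift i k == i]eq_sym (negPf (neq_lift i k)) !mulr0 subr0.
Qed.

Lemma compact_drop n i (K : set 'rV[R]_n.+1) :
  compact K -> compact (drop_coord i @` K).
Proof. by rewrite -(proj_delta i 1); exact: compact_proj. Qed.

Lemma cvx_drop n i (K : set 'rV[R]_n.+1) : cvx K -> cvx (drop_coord i @` K).
Proof. by rewrite -(proj_delta i 1); exact: cvx_proj. Qed.

Lemma cube_sub_drop n i (K : set 'rV[R]_n.+1) m : 0 < m -> cube _ m `<=` K ->
  cube n m `<=` drop_coord i @` K.
Proof.
move=> m0 mK y ym; exists (ins i y); last exact: drop_ins.
apply: mK => j; case: (unliftP i j) => [k|] ->.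
  by rewrite ins_lift.
by rewrite ins_same normr0 ltW.
Qed.

(** The polar of a projection is a central section of the polar, which lies in
    the projection of the polar. *)
Lemma polar_drop_sub n i (K : set 'rV[R]_n.+1) :
  polar (drop_coord i @` K) `<=` drop_coord i @` polar K.
Proof.
move=> y Ky; exists (ins i y); last exact: drop_ins.
move=> x Kx; rewrite (_ : dotv _ _ = dotv y (drop_coord i x)).
  by apply: Ky; exists x.
rewrite /dotv (bigD1_ord i)//= ins_same mul0r add0r.
by apply: eq_bigr => k _; rewrite ins_lift mxE.
Qed.

Lemma sweeps_cube n (s : seq 'I_n.+1) (a : R) y : 0 <= a -> uniq s ->
  sweeps [seq (i, a *: delta_mx 0 i) | i <- s] [set 0] y ->
  forall j, `|y 0 j| <= a *+ (j \in s).
Proof.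
move=> a0; elim: s y => [|i s IH] y /=; first by move=> _ -> j; rewrite mxE normr0.
move=> /andP[si us] [x [c [xs c1 ->]]] j.
rewrite !mxE eqxx /= in_cons.
have := IH _ us xs j; have [->|ji] := eqVneq j i.
  rewrite (negPf si) mulr0n normr_le0 => /eqP ->.
  by rewrite add0r mulr1 normrM (ger0_norm a0) mulr1n ler_piMl.
by rewrite !mulr0 addr0.
Qed.

(** [zonotope_volume] for the coordinate segments, whose sum is the cube. *)
Lemma vol_ge_cube n (L : set 'rV[R]_n.+1) a : 0 < a -> compact L -> cvx L ->
  cube _ a `<=` L ->
  2 * a * \sum_i vol (drop_coord i @` L) <= n.+1%:R * vol L.
Proof.
move=> a0 cL vL aL.
have := @zonotope_volume R n [seq (i, a *: delta_mx 0 i) | i <- enum 'I_n.+1] L.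
move=> /(_ _ cL vL) H; apply: le_trans (H _ _).
- rewrite big_map big_enum /= mulr_sumr le_eqVlt; apply/orP; left; apply/eqP.
  apply: eq_bigr => i _; rewrite proj_delta !mxE !eqxx mulr1 gtr0_norm//.
- move=> _ /mapP [i _ ->] /=; rewrite !mxE !eqxx mulr1; exact: lt0r_neq0.
- move=> y /sweeps_cube yc; apply: aL => j.
  by have := yc (ltW a0) (enum_uniq _) j; rewrite mem_enum inE mulr1n.
Qed.

(** Let a be the maximum over K of the mean of the |x_i|.  Then K contains the cube
    of half-side a by hypothesis, and polar K the cube of half-side 1/((n+1)a),
    because y.x <= (max |y_i|) sum |x_i|.  Both volumes are bounded below by
    [vol_ge_cube]. *)
Lemma volume_product_step n (K : set 'rV[R]_n.+1) (M : set 'rV[R]_n) m :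
  compact K -> cvx K -> 0 < m -> cube _ m `<=` K ->
  (forall x, K x -> cube _ ((\sum_i `|x 0 i|) / n.+1%:R) `<=` K) ->
  (forall i, drop_coord i @` K = M) ->
  4 / n.+1%:R * (vol M * vol (polar M)) <= vol K * vol (polar K).
Proof.
move=> cK vK m0 mK meanK KM.
have n0 : 0 < n.+1%:R :> R by rewrite ltr0n.
have cP : compact (polar K) := compact_polar m0 mK.
have M0 : cube n m `<=` M by rewrite -(KM ord0); exact: cube_sub_drop.
have K0 : K !=set0 by exists 0; apply: mK => j; rewrite mxE normr0 ltW.
have cS : {within K, continuous (fun x : 'rV[R]_n.+1 => \sum_i `|x 0 i|)}.
  apply: continuous_subspaceT; apply: continuous_sum => i y.
  apply: (@continuous_comp _ _ _
    (fun x : 'rV[R]_n.+1 => x 0 i) (fun r : R => `|r|)).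
    exact: coord_continuous.
  exact: norm_continuous.
have [x Kx xmax] := compact_EVT_max K0 cK cS.
pose S := \sum_i `|x 0 i|.
have S0 : 0 < S.
  have Km : K (m *: delta_mx 0 ord0) by apply/mK/cube_delta; rewrite gtr0_norm.
  apply: lt_le_trans (xmax _ (mem_set Km)).
  rewrite (bigD1 ord0)//= !mxE !eqxx mulr1 gtr0_norm// ltr_pwDl//.
  by apply: sumr_ge0.
pose a := S / n.+1%:R; pose b := S^-1.
have a0 : 0 < a by rewrite divr_gt0.
have b0 : 0 < b by rewrite invr_gt0.
have hK := vol_ge_cube a0 cK vK (meanK _ (set_mem Kx)).
have hP : 2 * b * \sum_i vol (drop_coord i @` polar K) <= n.+1%:R * vol (polar K).
  apply: vol_ge_cube => //; first exact: cvx_polar.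
  apply: cube_sub_polar => y Ky; rewrite mulrC ler_pdivrMr// mul1r.
  exact: xmax (mem_set Ky).
have {}hK : 2 * a * vol M <= vol K.
  rewrite -(ler_pM2l n0); apply: le_trans hK.
  rewrite (eq_bigr (fun=> vol M)) => [|i _]; last by rewrite KM.
  by rewrite sumr_const card_ord -[vol M *+ _]mulr_natl [leRHS]mulrCA.
have {}hP : 2 * b * vol (polar M) <= vol (polar K).
  rewrite -(ler_pM2l n0); apply: le_trans hP.
  rewrite [leLHS]mulrCA ler_pM2l ?mulr_gt0// mulr_natl.
  rewrite -{1}[n.+1]card_ord -sumr_const; apply: ler_sum => i _.
  apply: le_vol; [exact: compact_polar M0|exact: compact_drop|].
  by rewrite -(KM i); exact: polar_drop_sub.
have -> : 4 / n.+1%:R * (vol M * vol (polar M)) =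
  (2 * a * vol M) * (2 * b * vol (polar M)).
  by rewrite /a /b; field; rewrite !lt0r_neq0.
by apply: ler_pM => //; rewrite !mulr_ge0 ?vol_ge0// ltW.
Qed.

Lemma drop_signed_perm n (s : 'S_n) i j e (x : 'rV[R]_n.+1) :
  drop_coord i (signed_perm (lift_perm i j s) e x) =
  signed_perm s (fun k => e (lift i k)) (drop_coord j x).
Proof. by apply/rowP => k; rewrite !mxE lift_perm_lift. Qed.

(** A signed permutation of the hyperplane extends to a rotation, by a suitable
    choice of sign for the remaining coordinate. *)
Lemma rotation_inv_drop n (K : set 'rV[R]_n.+1) i j (s : 'S_n) e x :
  rotation_inv K -> K x -> exists2 y, K y & drop_coord i y =
    signed_perm s e (drop_coord j x).
Proof.
move=> iK Kx; pose t := lift_perm i j s.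
pose f k := oapp e (odd_perm t (+) \big[addb/false]_k e k) (unlift i k).
have fl k : f (lift i k) = e k by rewrite /f liftK.
exists (signed_perm t f x).
  apply: iK => //; rewrite (bigD1_ord i)//= (eq_bigr e) => [|k _]; last exact: fl.
  by rewrite /f unlift_none /= addbK.
by rewrite drop_signed_perm; congr signed_perm; apply/funext => k; exact: fl.
Qed.

Lemma drop_rotation_inv n (K : set 'rV[R]_n.+1) i :
  rotation_inv K -> hyperoctahedral_inv (drop_coord i @` K).
Proof.
move=> iK s e _ [x Kx <-].
by have [y Ky yx] := rotation_inv_drop i i s e iK Kx; exists y.
Qed.

Lemma signed_perm1 n (x : 'rV[R]_n) : signed_perm 1 (fun=> false) x = x.
Proof. by apply/rowP => j; rewrite mxE perm1 expr0 mul1r. Qed.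

Lemma drop_image n (K : set 'rV[R]_n.+1) i j :
  rotation_inv K -> drop_coord i @` K = drop_coord j @` K.
Proof.
move=> iK; suff sub k l : drop_coord k @` K `<=` drop_coord l @` K by apply/seteqP.
move=> _ [x Kx <-].
by have [y Ky] := rotation_inv_drop l k 1 (fun=> false) iK Kx;
  rewrite signed_perm1; exists y.
Qed.

Lemma rotation_inv_step n (K : set 'rV[R]_n.+1) m :
  compact K -> cvx K -> 0 < m -> cube _ m `<=` K -> rotation_inv K ->
  hyperoctahedral_inv K \/ (2 <= n)%N ->
  4 / n.+1%:R * (vol (drop_coord ord0 @` K) * vol (polar (drop_coord ord0 @` K)))
    <= vol K * vol (polar K).
Proof.
move=> cK vK m0 mK rK iK; apply: volume_product_step m0 mK _ _ => //.
- by move=> x; apply: mean_cube => //; case: iK => [?|n2]; [left|right].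
- by move=> i; exact: drop_image.
Qed.

Lemma vol_cube n (a : R) : 0 <= a -> vol (cube n a) = (2 * a) ^+ n.
Proof. by move=> a0; rewrite /vol volume_cube. Qed.

Theorem hyperoctahedral_volume_product n (K : set 'rV[R]_n) m :
  compact K -> cvx K -> 0 < m -> cube _ m `<=` K -> hyperoctahedral_inv K ->
  4 ^+ n / n`!%:R <= vol K * vol (polar K).
Proof.
elim: n K => [|n IH] K cK vK m0 mK iK.
  have KE (L : set 'rV[R]_0) : (forall y, L y) -> vol L = 1.
    move=> LT; rewrite -(expr0 (2 * 0 : R)) -vol_cube//; congr vol.
    by apply/seteqP; split => // y _ [].
  rewrite !KE ?fact0 ?expr0 ?divr1 ?mulr1//.
  - by move=> y x _; rewrite /dotv big_ord0.
  - by move=> y; apply: mK => -[].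
have rK := hyperoctahedral_rotation_inv iK.
apply: le_trans (rotation_inv_step cK vK m0 mK rK (or_introl iK)).
have := IH (drop_coord ord0 @` K) (compact_drop (i := ord0) cK) (cvx_drop vK) m0
  (cube_sub_drop ord0 m0 mK) (drop_rotation_inv rK).
move=> h; rewrite factS natrM exprS (_ : _ / _ = 4 / n.+1%:R * (4 ^+ n / n`!%:R)).
  by apply: ler_wpM2l h; rewrite divr_ge0.
by rewrite invfM mulrACA.
Qed.

Theorem rotation_volume_product n (K : set 'rV[R]_n) m : (3 <= n)%N ->
  compact K -> cvx K -> 0 < m -> cube _ m `<=` K -> rotation_inv K ->
  4 ^+ n / n`!%:R <= vol K * vol (polar K).
Proof.
case: n K => // n K n2 cK vK m0 mK rK.
apply: le_trans (rotation_inv_step cK vK m0 mK rK (or_intror n2)).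
have := hyperoctahedral_volume_product (compact_drop (i := ord0) cK)
  (cvx_drop vK) m0
  (cube_sub_drop ord0 m0 mK) (drop_rotation_inv rK).
move=> h; rewrite factS natrM exprS (_ : _ / _ = 4 / n.+1%:R * (4 ^+ n / n`!%:R)).
  by apply: ler_wpM2l h; rewrite divr_ge0.
by rewrite invfM mulrACA.
Qed.

End polar_bodies.

(** * Quarter turns of the plane *)

Section plane.
Context (R : realType).

Definition pt (a b : R) : 'rV[R]_2 := \row_j (if j == 0 then a else b).

Lemma pt_eta (x : 'rV[R]_2) : x = pt (x 0 0) (x 0 1).
Proof.
apply/rowP => j; rewrite mxE; have [->//|j0] := eqVneq j 0.
by congr (x _ _); apply/val_inj; case: j j0 => -[|[]].
Qed.

Lemma ptD a b c d s t : s *: pt a b + t *: pt c d =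
  pt (s * a + t * c) (s * b + t * d).
Proof. by apply/rowP => j; rewrite !mxE; case: eqP. Qed.

Lemma dotv_pt a b c d : dotv (pt a b) (pt c d) = a * c + b * d.
Proof. by rewrite /dotv big_ord_recl big_ord1 !mxE. Qed.

Definition quarter_turn_inv (K : set 'rV[R]_2) :=
  forall a b, K (pt a b) -> K (pt (- b) a).

Lemma quarter_turn_inv_opp K a b :
  quarter_turn_inv K -> K (pt a b) -> K (pt (- a) (- b)).
Proof. by move=> JK /JK /JK. Qed.

Lemma rotation_quarter_turn_inv (K : set 'rV[R]_2) :
  rotation_inv K -> quarter_turn_inv K.
Proof.
move=> rK a b Kab.
rewrite (_ : pt _ _ = signed_perm (tperm 0 1) (fun j => j == 0) (pt a b)).
  by apply: rK Kab; rewrite odd_tperm big_ord_recl big_ord1.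
apply/rowP => j; rewrite !mxE; have [->|j0] := eqVneq j 0.
  by rewrite tpermL expr1 mulN1r.
have -> : j = 1 by apply/val_inj; case: j j0 => -[|[]].
by rewrite tpermR /= expr0 mul1r.
Qed.

Lemma quarter_turn_polar (K : set 'rV[R]_2) :
  quarter_turn_inv K -> quarter_turn_inv (polar K).
Proof.
move=> JK a b Pab x Kx; rewrite [x]pt_eta dotv_pt.
have Kx' : K (pt (x 0 1) (- x 0 0)).
  by move: Kx; rewrite [x in K x]pt_eta => /JK /JK /JK; rewrite opprK.
by have := Pab _ Kx'; rewrite dotv_pt; lra.
Qed.

Lemma rV1_eta (x : 'rV[R]_1) : x = \row_j x 0 0.
Proof. by apply/rowP => j; rewrite mxE ord1. Qed.

Lemma vol_segment_ge (P : set 'rV[R]_1) x : compact P -> cvx P -> P x -> P (- x) ->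
  2 * `|x 0 0| <= vol P.
Proof.
move=> cP vP Px PNx; rewrite -[leLHS]expr1 -vol_cube//.
apply: le_vol => //; first exact: compact_cube.
apply: cube_of_vertices => // e.
suff : P (\row_j `|x 0 0|) /\ P (\row_j (- `|x 0 0|)).
  move=> [P1 P2]; case: (boolP (e 0)) => e0.
    by move: P2; congr P; apply/rowP => j; rewrite !mxE ord1 e0 expr1 mulN1r.
  by move: P1; congr P; apply/rowP => j; rewrite !mxE ord1 (negPf e0) expr0 mul1r.
have Nx : - x = \row_j (- x 0 0).
  by apply/rowP => j; rewrite !mxE ord1.
move: Px PNx; rewrite Nx {1}[x]rV1_eta.
by case: (ger0P (x 0 0)) => _ ? ?; split; rewrite ?opprK.
Qed.

Lemma quarter_turn_square (L : set 'rV[R]_2) u1 u2 c d :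
  cvx L -> quarter_turn_inv L -> L (pt (u1 - u2) (u1 + u2)) ->
  `|c| <= 1 -> `|d| <= 1 -> L (pt (c * u1 - d * u2) (c * u2 + d * u1)).
Proof.
move=> vL JL Lu; rewrite !ler_norml => /andP[cl cu] /andP[dl du].
have mid z w (t : R) : -1 <= t -> t <= 1 -> L z -> L w ->
    L ((1 + t) / 2 *: z + (1 - t) / 2 *: w).
  by move=> tl tu; apply: vL; lra.
have L2 := JL _ _ Lu; have L3 := JL _ _ L2; have L4 := JL _ _ L3.
have := mid _ _ c cl cu (mid _ _ d dl du Lu L4) (mid _ _ d dl du L2 L3).
by rewrite !ptD; congr (L (pt _ _)); field.
Qed.

(** [zonotope_volume] for the square with vertices +-u+-Ju, where J is the quarter
    turn.  The projection of L along u contains those of +-Jq, and the projection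
    along Ju those of +-q; |u_1| times either length, read in the remaining
    coordinate, is at least 2 |u.q|. *)
Lemma quarter_turn_volume (L : set 'rV[R]_2) u1 u2 q1 q2 :
  compact L -> cvx L -> quarter_turn_inv L -> u1 != 0 ->
  L (pt (u1 - u2) (u1 + u2)) -> L (pt q1 q2) ->
  4 * (u1 * q1 + u2 * q2) <= vol L.
Proof.
move=> cL vL JL u0 Lu Lq.
pose u := pt u1 u2; pose Ju := pt (- u2) u1.
have := @zonotope_volume R 1 [:: (0, u); (1, Ju)] L.
rewrite !big_cons big_nil /= addr0 => H.
have {}H := H _ cL vL _.
have Lsquare : sweeps [:: (0, u); (1, Ju)] [set 0] `<=` L.
  move=> _ [_ [c [[_ [d [-> d1 ->]]] c1 ->]]] /=.
  have := quarter_turn_square vL JL Lu c1 d1; congr L.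
  rewrite add0r addrC /u /Ju ptD; congr pt; ring.
have {}H : 2 * `|u1| * vol (proj_along 0 u @` L) +
    2 * `|u1| * vol (proj_along 1 Ju @` L) <= 2 * vol L.
  have := H _ Lsquare; rewrite !mxE /=; apply => iw; rewrite !inE.
  by case/orP => /eqP -> /=; rewrite mxE.
have p0 : 2 * `|(u1 * q1 + u2 * q2) / u1| <= vol (proj_along 0 u @` L).
  have LJq := JL _ _ Lq; have LNJq := quarter_turn_inv_opp JL LJq.
  pose z : 'rV[R]_1 := proj_along 0 u (pt (- q2) q1).
  have -> : (u1 * q1 + u2 * q2) / u1 = z 0 0 by rewrite !mxE /=; field.
  apply: vol_segment_ge; [exact: compact_proj|exact: cvx_proj| |].
    by exists (pt (- q2) q1).
  exists (pt (- - q2) (- q1)) => //; apply/rowP => j.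
  by rewrite ord1 /z !mxE /=; field.
have p1 : 2 * `|(u1 * q1 + u2 * q2) / u1| <= vol (proj_along 1 Ju @` L).
  have LNq := quarter_turn_inv_opp JL Lq.
  pose z : 'rV[R]_1 := proj_along 1 Ju (pt q1 q2).
  have -> : (u1 * q1 + u2 * q2) / u1 = z 0 0 by rewrite !mxE /=; field.
  apply: vol_segment_ge; [exact: compact_proj|exact: cvx_proj| |].
    by exists (pt q1 q2).
  exists (pt (- q1) (- q2)) => //; apply/rowP => j.
  by rewrite ord1 /z !mxE /=; field.
have ua : 0 < `|u1| by rewrite normr_gt0.
have e1 : `|u1| * `|(u1 * q1 + u2 * q2) / u1| = `|u1 * q1 + u2 * q2|.
  by rewrite -normrM mulrCA mulfV// mulr1.
have := ler_norm (u1 * q1 + u2 * q2).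
have := ler_wpM2l (ltW ua) p0; have := ler_wpM2l (ltW ua) p1.
rewrite !(mulrCA `|u1| 2) e1; lra.
Qed.

(** Let y maximize x_1 + x_2 on K, u = (y - Jy)/2 and v = e_1/(y_1 + y_2).  Then
    u + Ju = y is in K, v + Jv is in the polar by maximality of y, and u.v = 1/2.
    The two bounds are [quarter_turn_volume] at a point q of K that maximizes u.q
    and at the point u/(u.q) of the polar. *)
Theorem quarter_turn_volume_product (K : set 'rV[R]_2) m :
  compact K -> cvx K -> 0 < m -> cube _ m `<=` K -> quarter_turn_inv K ->
  8 <= vol K * vol (polar K).
Proof.
move=> cK vK m0 mK JK.
have K0 : K !=set0 by exists 0; apply: mK => j; rewrite mxE normr0 ltW.
have form_max (a b : R) : exists2 y, K y & forall x, K x ->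
    a * x 0 0 + b * x 0 1 <= a * y 0 0 + b * y 0 1.
  have cf : {within K, continuous (fun x : 'rV[R]_2 => dotv (pt a b) x)}.
    by apply: continuous_subspaceT; exact: continuous_linear_form.
  have [y Ky ymax] := compact_EVT_max K0 cK cf.
  exists y; first exact: set_mem.
  by move=> x Kx; have := ymax _ (mem_set Kx);
    rewrite [x]pt_eta [y]pt_eta !dotv_pt !mxE.
have [y Ky ymax] := form_max 1 1.
have h : 0 < y 0 0 + y 0 1.
  apply: lt_le_trans (_ : 0 < m + m) _; first by rewrite addr_gt0.
  have Km : K (pt m m) by apply: mK => j; rewrite mxE; case: eqP => _;
    rewrite gtr0_norm.
  by have := ymax _ Km; rewrite !mxE /= !mul1r.
pose u1 := (y 0 0 + y 0 1) / 2; pose u2 := (y 0 1 - y 0 0) / 2.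
have [q Kq qmax] := form_max u1 u2.
pose H := u1 * q 0 0 + u2 * q 0 1.
have H0 : 0 < H.
  apply: lt_le_trans (qmax _ Ky); rewrite /u1 /u2.
  have := mulr_gt0 h h; have := sqr_ge0 (y 0 0 - y 0 1); nra.
have u10 : u1 != 0 by apply: lt0r_neq0; rewrite /u1 divr_gt0.
have vK4 : 4 * H <= vol K.
  apply: quarter_turn_volume => //; last by rewrite -pt_eta.
  rewrite (_ : pt _ _ = y) // [RHS]pt_eta.
  by congr pt; rewrite /u1 /u2; field.
have vP4 : 4 * ((y 0 0 + y 0 1)^-1 * (u1 / H) + 0 * (u2 / H)) <= vol (polar K).
  apply: quarter_turn_volume.
  - exact: compact_polar mK.
  - exact: cvx_polar.
  - exact: quarter_turn_polar.
  - by rewrite invr_neq0// lt0r_neq0.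
  - move=> x Kx; rewrite [x]pt_eta dotv_pt subr0 addr0 -mulrDr mulrC.
    by rewrite ler_pdivrMr// mul1r; have := ymax _ Kx; rewrite !mul1r.
  - move=> x Kx; rewrite [x]pt_eta dotv_pt mulrAC [u2 / H * _]mulrAC -mulrDl.
    by rewrite ler_pdivrMr// mul1r; exact: qmax.
set v1 := (y 0 0 + y 0 1)^-1 in vP4.
have v1u1 : v1 * u1 = 1 / 2 by rewrite /v1 /u1; field; exact: lt0r_neq0.
have {}vP4 : 2 / H <= vol (polar K).
  apply: le_trans vP4; rewrite mul0r addr0 (mulrA v1) v1u1 le_eqVlt.
  apply/orP; left.
  by apply/eqP; field; exact: lt0r_neq0.
apply: (@le_trans _ _ (4 * H * (2 / H))).
  by rewrite le_eqVlt; apply/orP; left; apply/eqP; field; exact: lt0r_neq0.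
have H40 : 0 <= 4 * H by rewrite mulr_ge0// ltW.
have H20 : 0 <= 2 / H by rewrite divr_ge0// ltW.
exact: ler_pM H40 H20 vK4 vP4.
Qed.

End plane.

(** * The unit ball of the l^1 norm *)

Section cross_polytopes.
Context (R : realType).
Notation lambda := (@lebesgue_measure R).
Implicit Types n : nat.

Definition l1_ball n (r : R) : set 'rV[R]_n := [set x | \sum_i `|x 0 i| <= r].
Arguments l1_ball : clear implicits.

Lemma continuous_l1 n : continuous (fun x : 'rV[R]_n => \sum_i `|x 0 i|).
Proof.
apply: continuous_sum => i y.
apply: (@continuous_comp _ _ _ (fun x : 'rV[R]_n => x 0 i) (fun r : R => `|r|)).
  exact: coord_continuous.
exact: norm_continuous.
Qed.

Lemma coord_le_l1 n (x : 'rV[R]_n) i : `|x 0 i| <= \sum_j `|x 0 j|.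
Proof. by rewrite (bigD1 i)//= lerDl sumr_ge0. Qed.

Lemma compact_l1_ball n r : compact (l1_ball n r).
Proof.
apply: (@subclosed_compact _ _ (cube n r)); last 2 first.
- exact: compact_cube.
- by move=> x xr i; apply: le_trans xr; exact: coord_le_l1.
apply: (@preimage_closed _ _
  (fun x : 'rV[R]_n => \sum_i `|x 0 i|) [set t | t <= r]).
  by move=> x _; exact: continuous_l1.
exact: closed_le.
Qed.

Lemma l1_ball0 n : l1_ball n 0 = cube n 0.
Proof.
apply/seteqP; split => x /= xr.
  by move=> i; apply: le_trans xr; exact: coord_le_l1.
by rewrite /l1_ball /= big1 // => i _; apply/eqP; rewrite eq_le xr normr_ge0.
Qed.

Lemma l1_ball_scale n r : 0 < r -> l1_ball n r = (fun x => r *: x) @` l1_ball n 1.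
Proof.
move=> r0; have sumZ c (x : 'rV[R]_n) : 0 < c ->
    \sum_i `|(c *: x) 0 i| = c * \sum_i `|x 0 i|.
  move=> c0; rewrite mulr_sumr; apply: eq_bigr => i _.
  by rewrite mxE normrM gtr0_norm.
apply/seteqP; split => x /=.
  move=> xr; exists (r^-1 *: x); last by rewrite scalerA mulfV ?scale1r// lt0r_neq0.
  by rewrite /l1_ball /= sumZ ?invr_gt0// mulrC ler_pdivrMr// mul1r.
by move=> [y y1 <-]; rewrite /l1_ball /= sumZ// ler_piMr// ltW.
Qed.

Lemma l1_ball_section n a :
  [set z : 'rV[R]_n | l1_ball n.+1 1 (consv a z)] = l1_ball n (1 - `|a|).
Proof.
have l1_consv z : \sum_i `|consv a z 0 i| = `|a| + \sum_i `|z 0 i|.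
  by rewrite big_ord_recl consv0; congr (_ + _); apply: eq_bigr => i _;
    rewrite consvS.
by apply/seteqP; split => z; rewrite /l1_ball /= l1_consv lerBrDl.
Qed.

Lemma integral_onemXn n :
  (\int[lambda]_(x in `[0%R, 1%R]) (onem x ^+ n)%:E = (n.+1%:R^-1)%:E)%E.
Proof.
rewrite (@continuous_FTC2 _ _ (fun x => onem x ^+ n.+1 / - n.+1%:R))//=.
- rewrite -EFinB onem1 expr0n/= mul0r onem0 expr1n mul1r sub0r.
  by rewrite -invrN opprK.
- by apply: continuous_in_subspaceT => x x01; exact: continuous_onemXn.
- exact: derivable_oo_LRcontinuous_onemXnMr.
- move=> x x01; rewrite derive1Mr//; last exact: onemXn_derivable.
  by rewrite derive_onemXn mulrAC divff// mul1r.
Qed.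

Lemma continuous_onem_normXn n : continuous (fun x : R => onem `|x| ^+ n).
Proof.
move=> x.
apply: (@continuous_comp _ _ _ (fun r : R => `|r|) (fun r => onem r ^+ n)).
  exact: norm_continuous.
exact: continuous_onemXn.
Qed.

Lemma integral_onem_normXn n :
  (\int[lambda]_(x in `[(-1)%R, 1%R]) (onem `|x| ^+ n)%:E = (2 / n.+1%:R)%:E)%E.
Proof.
have cf := @continuous_onem_normXn n.
have mf A : measurable A ->
    measurable_fun A (fun x : R => (onem `|x| ^+ n)%:E : \bar R).
  move=> mA; apply/measurable_EFinP; apply: measurable_funTS.
  exact: continuous_measurable_fun.
rewrite (@itv_bndbnd_setU _ _ (BLeft (-1 : R)) (BRight 0) (BRight 1)) ?bnd_simp
  ?lerN10//.
rewrite ge0_integral_setU//=; last 3 first.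
- by apply: mf; exact: measurableU.
- move=> x; rewrite !in_itv /= => x1; rewrite lee_fin exprn_ge0// /onem subr_ge0.
  by rewrite ler_norml; apply/andP; case: x1 => /andP[? ?]; split; lra.
- by apply/disj_setPRL => x /=; rewrite !in_itv /= => /andP[x0 _] /andP[_];
  rewrite leNgt x0.
rewrite integral_itv_obnd_cbnd; last by apply: mf; exact: measurable_itv.
have -> : (2 / n.+1%:R)%:E = (n.+1%:R^-1%:E + n.+1%:R^-1%:E :> \bar R)%E.
  by rewrite -EFinD; congr EFin; ring.
congr (_ + _)%E; rewrite -(integral_onemXn n).
  rewrite -[X in `[_, X]]oppr0 integration_by_substitution_oppr//.
    apply: eq_integral => x /set_mem /=; rewrite in_itv /= => /andP[x0 _].
    by rewrite normrN ger0_norm.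
  by apply: continuous_subspaceT.
apply: eq_integral => x /set_mem /=; rewrite in_itv /= => /andP[x0 _].
by rewrite ger0_norm.
Qed.

(** The slice at height a of the unit ball is a ball of radius 1 - |a| in one
    dimension less. *)
Lemma vol_l1_ball n r : 0 <= r -> vol (l1_ball n r) = (2 * r) ^+ n / n`!%:R.
Proof.
elim: n r => [|n IH] r r0.
  have -> : l1_ball 0 r = cube 0 r.
    by apply/seteqP; split => x _; [move=> [] | rewrite /l1_ball /= big_ord0].
  by rewrite vol_cube// !expr0 fact0 divr1.
suff V1 : vol (l1_ball n.+1 1) = 2 ^+ n.+1 / n.+1`!%:R.
  move: r0; rewrite le_eqVlt => /predU1P[<-|r0].
    by rewrite l1_ball0 vol_cube// !mulr0 exprS !mul0r.
  rewrite l1_ball_scale// vol_scale//; last exact: compact_l1_ball.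
  by rewrite V1 exprMn; ring.
have c0 : 0 <= 2 ^+ n / n`!%:R :> R by rewrite divr_ge0// exprn_ge0.
pose g (a : R) : \bar R := ((2 ^+ n / n`!%:R)%:E * (onem `|a| ^+ n)%:E)%E.
have -> : vol (l1_ball n.+1 1) =
    fine (\int[lambda]_(a in `[(-1)%R, 1%R]) g a)%E; last first.
  rewrite ge0_integralZl//=; last 2 first.
  - apply/measurable_EFinP; apply: measurable_funTS;
    apply: continuous_measurable_fun.
    exact: continuous_onem_normXn.
  - move=> x; rewrite in_itv /= => x1; rewrite lee_fin exprn_ge0// /onem subr_ge0.
    by rewrite ler_norml.
  rewrite integral_onem_normXn -EFinM /= factS natrM exprS invfM.
  by ring.
congr fine; rewrite volume_sections [RHS]integral_mkcond; apply: eq_integral => a _.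
rewrite l1_ball_section patchE; case: ifPn.
  move=> /set_mem /=; rewrite in_itv /= -ler_norml => a1.
  rewrite volE; last exact: compact_l1_ball.
  rewrite IH ?subr_ge0// /g -EFinM; congr EFin; rewrite exprMn /onem; ring.
rewrite notin_setE /= in_itv /= -ler_norml => /negP; rewrite -ltNge => a1.
rewrite (_ : l1_ball _ _ = set0); first exact: measure0.
apply/seteqP; split => // x; rewrite /l1_ball /= => x1.
have : 0 <= \sum_i `|x 0 i| by apply: sumr_ge0.
by move=> /le_trans /(_ x1); rewrite subr_ge0 leNgt a1.
Qed.
End cross_polytopes.
Arguments l1_ball : clear implicits.

(** * The cross-polytope and its rotation group *)

Section cross_polytope_rotations.
Context (R : realType).
Implicit Types n : nat.

Lemma convex_setP n (K : set 'rV[R]_n) :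
  convex_set (K : set (convex_lmodType 'rV[R]_n)) <-> cvx K.
Proof.
split=> [vK x y a b a0 b0 ab Kx Ky|vK x y l /set_mem Kx /set_mem Ky].
  have a1 : a <= 1 by rewrite -ab lerDl.
  have := vK x y (Itv01 a0 a1) (mem_set Kx) (mem_set Ky).
  move=> /set_mem; congr K; congr (_ + _ *: _).
  by rewrite /onem /= -ab addrAC subrr add0r.
apply: mem_set; apply: vK => //.
- exact: onem_ge0.
- exact: add_onemK.
Qed.

(** The origin takes the missing weight. *)
Lemma cvx_sum n (K : set 'rV[R]_n) (I : Type) (r : seq I) (w : I -> R)
    (p : I -> 'rV[R]_n) : cvx K -> K 0 -> (forall i, 0 <= w i) ->
  (forall i, K (p i)) -> \sum_(i <- r) w i <= 1 -> K (\sum_(i <- r) w i *: p i).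
Proof.
move=> vK K0 w0 Kp; set s := \sum_(i <- r) w i => s1.
have s0 : 0 <= s by apply: sumr_ge0.
suff [z Kz ->] : exists2 z, K z & \sum_(i <- r) w i *: p i = s *: z.
  have := vK z 0 s (1 - s) s0 _ _ Kz K0; rewrite scaler0 addr0; apply.
  - by rewrite subr_ge0.
  - by rewrite addrCA subrr addr0.
rewrite /s {s s1 s0}; elim: r => [|i r [z Kz IH]].
  by exists 0 => //; rewrite !big_nil scaler0.
rewrite !big_cons IH; set s := \sum_(j <- r) w j.
have s0 : 0 <= s by apply: sumr_ge0.
have [ws|ws] := eqVneq (w i + s) 0.
  exists 0 => //; have := w0 i => wi0.
  have -> : w i = 0 by lra.
  have -> : s = 0 by lra.
  by rewrite !addr0 !scale0r addr0.
exists ((w i / (w i + s)) *: p i + (s / (w i + s)) *: z); last first.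
  by rewrite scalerDr !scalerA ![(w i + s) * _]mulrCA mulfV// !mulr1.
have ws0 : 0 <= w i + s by rewrite addr_ge0.
by apply: vK => //; rewrite ?divr_ge0//; field.
Qed.

Lemma cvx_l1_ball n r : cvx (@l1_ball R n r).
Proof.
move=> x y a b a0 b0 ab; rewrite /l1_ball /= => xr yr.
apply: (@le_trans _ _ (a * (\sum_i `|x 0 i|) + b * (\sum_i `|y 0 i|))).
  rewrite !mulr_sumr -big_split /=; apply: ler_sum => i _.
  by rewrite !mxE (le_trans (ler_normD _ _))// !normrM (ger0_norm a0)
    (ger0_norm b0).
apply: (@le_trans _ _ (a * r + b * r)); first by rewrite lerD// ler_wpM2l.
by rewrite -mulrDl ab mul1r.
Qed.

Lemma l1_delta n (c : R) (i : 'I_n) :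
  \sum_j `|(c *: delta_mx 0 i : 'rV[R]_n) 0 j| = `|c|.
Proof.
rewrite (bigD1 i)//= big1 ?addr0 => [|j /negPf ji].
  by rewrite !mxE !eqxx mulr1.
by rewrite !mxE ji andbF mulr0 normr0.
Qed.

Lemma cross_polytopeE n : (0 < n)%N -> cross_polytope R n = l1_ball R n 1.
Proof.
move=> n0; apply/seteqP; split.
  apply: smallest_sub; first exact/convex_setP/cvx_l1_ball.
  move=> _ [i [->|->]]; rewrite /l1_ball /=.
    by rewrite -[delta_mx _ _]scale1r l1_delta normr1.
  by rewrite -scaleN1r l1_delta normrN1.
move=> x x1 C [/convex_setP vC gC].
have Ce i : C (delta_mx 0 i) by apply: gC; exists i; left.
have CNe i : C (- delta_mx 0 i) by apply: gC; exists i; right.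
have C0 : C 0.
  have := vC _ _ (1 / 2) (1 / 2) _ _ _ (Ce (Ordinal n0)) (CNe (Ordinal n0)).
  by rewrite scalerN subrr; apply; lra.
have -> : x = \sum_i `|x 0 i| *: ((-1) ^+ (x 0 i < 0)%R *: delta_mx 0 i).
  rewrite [LHS]row_sum_delta; apply: eq_bigr => i _.
  by rewrite scalerA mulrC -sign_norm mulrA -signr_addb addbb mul1r.
apply: cvx_sum => // i; case: (x 0 i < 0)%R.
  by rewrite expr1 scaleN1r.
by rewrite expr0 scale1r.
Qed.

Lemma polar_l1_ball n : polar (l1_ball R n 1) = cube n 1.
Proof.
apply/seteqP; split; last by apply: cube_sub_polar => x; rewrite mul1r.
move=> y Py i; have := Py ((-1) ^+ (y 0 i < 0)%R *: delta_mx 0 i).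
rewrite dotv_delta sign_norm; apply.
by rewrite /l1_ball /= l1_delta normrX normrN1 expr1n.
Qed.

Definition signed_perm_mx n (s : 'S_n) (e : 'I_n -> bool) : 'M[R]_n :=
  diag_mx (\row_j (-1) ^+ e j) *m perm_mx s.

Lemma signed_perm_mxE n (s : 'S_n) e j k :
  signed_perm_mx s e j k = (-1) ^+ e j * (s j == k)%:R.
Proof. by rewrite /signed_perm_mx mul_diag_mx !mxE. Qed.

Lemma mx_act_signed_perm n (s : 'S_n) e (x : 'rV[R]_n) :
  mx_act (signed_perm_mx s e) x = signed_perm s e x.
Proof.
apply/rowP => j; rewrite mxE (bigD1 (s j))//= big1 => [|k /negPf kj].
  by rewrite addr0 mxE signed_perm_mxE eqxx mulr1 mulrC mxE.
by rewrite [X in _ * X]mxE signed_perm_mxE eq_sym kj !mulr0.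
Qed.

Lemma signed_perm_mx_SO n (s : 'S_n) (e : 'I_n -> bool) :
  \big[addb/false]_j e j = s -> special_orthogonal (signed_perm_mx s e).
Proof.
move=> es; split.
  rewrite /signed_perm_mx trmx_mul tr_perm_mx tr_diag_mx.
  rewrite mulmxA -(mulmxA _ (perm_mx s)) -perm_mxM mulgV perm_mx1 mulmx1.
  rewrite mulmx_diag; apply/matrixP => i j; rewrite !mxE -expr2 sqrr_sign.
  by case: eqP.
rewrite det_mulmx det_diag det_perm.
rewrite (eq_bigr (fun j => (-1) ^+ e j)) => [|j _]; last by rewrite mxE.
have -> : \prod_j (-1) ^+ e j = (-1) ^+ (\big[addb/false]_j e j) :> R.
  apply/esym; apply: (big_morph (fun b : bool => (-1) ^+ b : R)) => [b c|].
    exact: signr_addb.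
  exact: expr0.
by rewrite es -signr_addb addbb.
Qed.

Lemma signed_permK n (s : 'S_n) e (x : 'rV[R]_n) :
  signed_perm s e (signed_perm s^-1 (fun j => e ((s^-1)%g j)) x) = x.
Proof.
by apply/rowP => j; rewrite !mxE permK mulrA -signr_addb addbb mul1r.
Qed.

Lemma signed_perm_l1_ball n (s : 'S_n) e r x :
  l1_ball R n r x -> l1_ball R n r (signed_perm s e x).
Proof.
rewrite /l1_ball /= (reindex_inj (@perm_inj _ s)) /=.
rewrite (eq_bigr (fun j => `|signed_perm s e x 0 j|))// => j _.
by rewrite mxE normrM normrX normrN1 expr1n mul1r.
Qed.

Lemma SO_stab_rotation_inv n (K : set 'rV[R]_n) : (0 < n)%N ->
  (forall g : 'M[R]_n, SO_stab (cross_polytope R n) g -> mx_act g @` K = K) ->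
  rotation_inv K.
Proof.
move=> n0 gK s e x es Kx; rewrite -mx_act_signed_perm.
rewrite -(gK (signed_perm_mx s e)); first by exists x.
split; first exact: signed_perm_mx_SO.
rewrite cross_polytopeE//; apply/seteqP; split => y.
  by move=> [z z1 <-]; rewrite mx_act_signed_perm; exact: signed_perm_l1_ball.
move=> y1; exists (signed_perm s^-1 (fun j => e ((s^-1)%g j)) y).
  exact: signed_perm_l1_ball.
by rewrite mx_act_signed_perm signed_permK.
Qed.

(** If n >= 3, [mean_cube] applies to a nonzero point of K.  In the plane -1 is a
    rotation, so that K contains the half-sum of a ball and of its opposite. *)
Lemma rotation_inv_cube n (K : set 'rV[R]_n) : (2 <= n)%N -> cvx K ->
  K° !=set0 -> rotation_inv K -> exists2 m, 0 < m & cube n m `<=` K.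
Proof.
move=> n2 vK [x0 /nbhs_ballP [e /= e0 eK]] rK.
have Kx v : cube n (e / 2) v -> K (x0 + v).
  move=> ve; apply: eK; split => // i j.
  rewrite ord1 /ball /= !mxE opprD addrA subrr sub0r normrN.
  by apply: le_lt_trans (ve j) _; rewrite ltr_pdivrMr// ltr_pMr// ltr1n.
have e2 : 0 < e / 2 by rewrite divr_gt0.
move: n2; rewrite leq_eqVlt => /predU1P[n2|n3].
  exists (e / 2) => // v ve.
  have KN z : K z -> K (- z).
    move=> Kz; rewrite (_ : - z = signed_perm 1 (fun=> true) z).
      apply: rK => //; rewrite odd_perm1; move: n2 => {}n2.
      by case: _ / n2; rewrite big_ord_recl big_ord1.
    by apply/rowP => j; rewrite !mxE perm1 expr1 mulN1r.
  have KNv : K (- (x0 - v)).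
    by apply/KN/Kx => i; rewrite mxE normrN.
  have := vK _ _ (1 / 2) (1 / 2) _ _ _ (Kx _ ve) KNv.
  have -> : (1 / 2) *: (x0 + v) + (1 / 2) *: - (x0 - v) = v.
    by apply/rowP => j; rewrite !mxE; field.
  by apply; lra.
have [z Kz z0] : exists2 z, K z & 0 < \sum_i `|z 0 i|.
  have sum_gt0 (z : 'rV[R]_n) : z != 0 -> 0 < \sum_i `|z 0 i|.
    move=> z0; rewrite lt_neqAle sumr_ge0// andbT eq_sym.
    apply: contra_neq z0 => /eqP; rewrite psumr_eq0// => /allP zi.
    apply/rowP => i; rewrite mxE; apply/eqP; rewrite -normr_eq0.
    exact: zi (mem_index_enum i).
  have K0 : K x0 by rewrite -[x0]addr0; apply: Kx => i; rewrite mxE normr0 ltW.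
  have [x00|x00] := eqVneq x0 0; last by exists x0 => //; exact: sum_gt0.
  have n0 : (0 < n)%N by exact: leq_trans n3.
  exists ((e / 2) *: delta_mx 0 (Ordinal n0)); last by rewrite l1_delta gtr0_norm.
  by rewrite -[X in K X]add0r -x00; apply/Kx/cube_delta; rewrite gtr0_norm.
exists ((\sum_i `|z 0 i|) / n%:R); last by apply: mean_cube => //; right.
by rewrite divr_gt0// ltr0n (leq_trans _ n3).
Qed.

Theorem rotation_inv_volume_product n (K : set 'rV[R]_n) m : (2 <= n)%N ->
  compact K -> cvx K -> 0 < m -> cube n m `<=` K -> rotation_inv K ->
  4 ^+ n / n`!%:R <= vol K * vol (polar K).
Proof.
move=> n2 cK vK m0 mK rK; move: (n2); rewrite leq_eqVlt => /predU1P[n2'|n3].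
  case: _ / n2' in K cK vK mK rK *.
  apply: le_trans (quarter_turn_volume_product cK vK m0 mK _).
    by rewrite (_ : 2`! = 2)%N// expr2; lra.
  exact: rotation_quarter_turn_inv.
exact: rotation_volume_product n3 cK vK m0 mK rK.
Qed.

Lemma cross_polytope_volume_product n : (0 < n)%N ->
  (volume (cross_polytope R n) * volume (polar (cross_polytope R n)))%E =
  (4 ^+ n / n`!%:R)%:E.
Proof.
move=> n0; rewrite cross_polytopeE// polar_l1_ball.
rewrite !volE; [|exact: compact_cube|exact: compact_l1_ball].
rewrite vol_l1_ball// vol_cube// -EFinM !mulr1 mulrAC -exprMn.
by congr (_%:E); congr (_ ^+ _ / _); rewrite -natrM.
Qed.

End cross_polytope_rotations.

Theorem theorem1p1 (R : realType) (n : nat) (K : set 'rV[R]_n) :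
  (2 <= n)%N ->
  convex_body K ->
  (forall g : 'M[R]_n, SO_stab (cross_polytope R n) g ->
     mx_act g @` K = K) ->
  (volume K * volume (polar K) >=
     volume (cross_polytope R n) *
     volume (polar (cross_polytope R n)))%E /\
  (volume (cross_polytope R n) *
     volume (polar (cross_polytope R n)))%E =
  (4 ^+ n / n`!%:R)%:E.
Proof.
move=> n2 [cK /convex_setP vK K0] gK.
have n0 : (0 < n)%N by exact: ltnW.
have rK := SO_stab_rotation_inv n0 gK.
have [m m0 mK] := rotation_inv_cube n2 vK K0 rK.
split; last exact: cross_polytope_volume_product.
rewrite cross_polytope_volume_product// !volE//; last exact: compact_polar mK.
by rewrite -EFinM lee_fin (rotation_inv_volume_product n2 cK vK m0).
Qed.
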